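(* There exists a (randomized) first-order method (called CSVRG) for continual finite-sum minimization with FO complexity $$O\left(\frac{L^{2/3}G^{2/3}}{\mu}\cdot\frac{n\log n}{\epsilon^{1/3}}+\frac{L^{2}G}{\mu^{5/2}}\cdot\frac{\log n}{\sqrt{\epsilon}}\right).$$ That is, given the accuracy target $\epsilon>0$ and any sequence of functions $f_1,\dots,f_n:\mathcal{D}\to\mathbb{R}$, each $\mu$-strongly convex, $L$-smooth and $G$-Lipschitz on the convex compact set $\mathcal{D}\subset\mathbb{R}^d$, the method outputs $\hat x_1,\dots,\hat x_n\in\mathcal{D}$ with $\mathbb{E}[g_i(\hat x_i)]-g_i(x_i^\star)\le\epsilon$ for every $i\in\{1,\dots,n\}$, while performing in total at most $O\left(\frac{L^{2/3}G^{2/3}}{\mu}\cdot\frac{n\log n}{\epsilon^{1/3}}+\frac{L^{2}G}{\mu^{5/2}}\cdot\frac{\log n}{\sqrt{\epsilon}}\right)$ first-order oracles.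
   Context: Setting. $\mathcal{D}\subset\mathbb{R}^d$ is nonempty, convex and compact; $\|\cdot\|$ is the Euclidean norm. Each $f_i:\mathcal{D}\to\mathbb{R}$ is differentiable and, for all $x,y\in\mathcal{D}$: $f_i(x)\ge f_i(y)+\nabla f_i(y)^\top(x-y)+\frac{\mu}{2}\|x-y\|^2$ ($\mu$-strong convexity, $\mu>0$); $|f_i(x)-f_i(y)|\le G\|x-y\|$, with $\|\nabla f_i(x)\|\le G$ ($G$-Lipschitz); $\|\nabla f_i(x)-\nabla f_i(y)\|\le L\|x-y\|$ ($L$-smooth). Prefix functions: $g_i(x):=\frac1i\sum_{j=1}^i f_j(x)$ and $x_i^\star:=\arg\min_{x\in\mathcal{D}}g_i(x)$. Continual finite-sum minimization: given $f_1,\dots,f_n$ and $\epsilon>0$, output $\hat x_1,\dots,\hat x_n\in\mathcal{D}$ with $g_i(\hat x_i)\le g_i(x_i^\star)+\epsilon$ for each $i$ (if $\hat x_i$ is random: $\mathbb{E}[g_i(\hat x_i)]-g_i(x_i^\star)\le\epsilon$). First-order method: it starts from a point $\hat x_0\in\mathcal{D}$ and proceeds in stages $i=1,\dots,n$. At stage $i$ it runs $T_i$ rounds; at round $t$ it performs a finite set $Q_i^t$ of first-order oracles (FOs), each FO being a pair $q=(q_{\rm value},q_{\rm index})$ with $q_{\rm value}\in\mathcal{D}$, $q_{\rm index}\le i$, which returns the gradient $\nabla f_{q_{\rm index}}(q_{\rm value})$; it uses the information gathered so far (and possibly internal randomness) to determine its intermediate points $x_i^t\in\mathcal{D}$, its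 subsequent queries, and finally the output $\hat x_i\in\mathcal{D}$ of stage $i$. The method may use the known quantities $\mathcal{D},\mu,L,G,\epsilon$. Its FO complexity is $\sum_{i=1}^n\sum_{t=1}^{T_i}|Q_i^t|$. The $O(\cdot)$ hides an absolute constant; it is understood for $n\ge2$ and all sufficiently small $\epsilon>0$ (the threshold may depend on $\mu,L,G,|\mathcal{D}|$, where $|\mathcal{D}|$ is the diameter of $\mathcal{D}$). *)

(* Defs.v *)
(* MathComp / MathComp-Analysis; R^d is 'rV[R]_d over R : realType. *)
From HB Require Import structures.
From mathcomp Require Import all_boot all_order all_algebra finmap.
From mathcomp Require Import all_classical all_reals all_analysis.

Set Implicit Arguments.
Unset Strict Implicit.
Unset Printing Implicit Defensive.

Import Order.TTheory GRing.Theory Num.Theory.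
Import numFieldNormedType.Exports.

Local Open Scope classical_set_scope.
Local Open Scope ring_scope.

Section Euclidean.
Variables (R : realType) (d : nat).
Implicit Types (x y : 'rV[R]_d) (D : set 'rV[R]_d).

Definition dot x y : R := \sum_(k < d) x 0 k * y 0 k.

(* The library norm `|x| on 'rV[R]_d is the sup norm; it induces the same
   topology, but the constants below refer to the Euclidean norm. *)
Definition enorm x : R := Num.sqrt (dot x x).

Definition diam D : R := sup [set enorm (x - y) | x in D & y in D].

End Euclidean.

Section Functions.
Variables (R : realType) (d : nat) (D : set 'rV[R]_d).

(* f is only meaningful on D, so differentiability at y \in D, boundary points
   included, is relative to D. At x = y the quotient is 0 / 0 = 0. *)
Definition is_gradient_on (f : 'rV[R]_d -> R) (df : 'rV[R]_d -> 'rV[R]_d) :=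
  forall y, D y ->
    (f x - f y - dot (df y) (x - y)) / enorm (x - y)
      @[x --> within D (nbhs y)] --> (0 : R).

Record admissible (mu L G : R) (f : 'rV[R]_d -> R)
    (df : 'rV[R]_d -> 'rV[R]_d) : Prop := Admissible {
  adm_gradient : is_gradient_on f df;
  adm_strongly_convex : forall x y, D x -> D y ->
    f y + dot (df y) (x - y) + mu / 2 * enorm (x - y) ^+ 2 <= f x;
  adm_lipschitz : forall x y, D x -> D y -> `|f x - f y| <= G * enorm (x - y);
  adm_gradient_bound : forall x, D x -> enorm (df x) <= G;
  adm_smooth : forall x y, D x -> D y ->
    enorm (df x - df y) <= L * enorm (x - y) }.

Definition is_argmin (g : 'rV[R]_d -> R) (x : 'rV[R]_d) :=
  D x /\ forall y, D y -> g x <= g y.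

End Functions.

Definition prefix_mean (R : realType) (d : nat) (f : nat -> 'rV[R]_d -> R)
    (i : nat) (x : 'rV[R]_d) : R :=
  i%:R^-1 * \sum_(1 <= j < i.+1) f j x.

(* An oracle call (q_value, q_index). *)
Definition query (R : realType) (d : nat) : choiceType :=
  ('rV[R]_d * nat)%type.

(* The information gathered so far: one entry per round already performed (over
   all stages, in chronological order), mapping each call of the round to the
   gradient it returned. *)
Definition history (R : realType) (d : nat) :=
  seq {fmap query R d -> 'rV[R]_d}.

(* In every rule the first argument is the stage i; [nrounds] and [output] see
   the history at the beginning, respectively at the end, of the stage;
   [iterate] and [queries] (the point x_i^t and the set Q_i^t) also take the
   round t >= 1 and see the history before that round. The number n of stages
   is not available to the rules. *)
Record first_order_method (R : realType) (d : nat) (D : set 'rV[R]_d) :=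
  FirstOrderMethod {
  start : 'rV[R]_d;
  nrounds : nat -> history R d -> nat;
  iterate : nat -> nat -> history R d -> 'rV[R]_d;
  queries : nat -> nat -> history R d -> {fset query R d};
  output : nat -> history R d -> 'rV[R]_d;
  start_in : D start;
  iterate_in : forall i t h, D (iterate i t h);
  queries_in : forall i t h (q : query R d), (0 < i)%N ->
    q \in queries i t h -> D q.1 /\ (1 <= q.2 <= i)%N;
  output_in : forall i h, D (output i h) }.

Section Execution.
Variables (R : realType) (d : nat) (D : set 'rV[R]_d).
Variables (M : first_order_method D) (df : nat -> 'rV[R]_d -> 'rV[R]_d).

Definition answers (Q : {fset query R d}) : {fmap query R d -> 'rV[R]_d} :=
  [fmap q : Q => df (val q).2 (val q).1]%fmap.

(* The history after t rounds of stage i, the stage having begun with h. *)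
Fixpoint run_rounds (i t : nat) (h : history R d) : history R d :=
  if t is s.+1 then
    let h' := run_rounds i s h in rcons h' (answers (queries M i s.+1 h'))
  else h.

(* The history at the end of stage i. *)
Fixpoint run_stages (i : nat) : history R d :=
  if i is k.+1 then
    let h := run_stages k in run_rounds k.+1 (nrounds M k.+1 h) h
  else [::].

Definition stage_output (i : nat) : 'rV[R]_d :=
  if i is 0 then start M else output M i (run_stages i).

Definition stage_nrounds (i : nat) : nat := nrounds M i (run_stages i.-1).

Definition stage_queries (i t : nat) : {fset query R d} :=
  queries M i t (run_rounds i t.-1 (run_stages i.-1)).

Definition fo_complexity (n : nat) : nat :=
  \sum_(1 <= i < n.+1) \sum_(1 <= t < (stage_nrounds i).+1)
    #|` stage_queries i t|.

End Execution.

(* All internal randomness is carried by a seed drawn once from an arbitrary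
   probability space. *)
Record randomized_method (R : realType) (d : nat) (D : set 'rV[R]_d) :=
  RandomizedMethod {
  seed_display : measure_display;
  seed : measurableType seed_display;
  seed_law : probability seed R;
  derandomize : seed -> first_order_method D }.

Definition random_output (R : realType) (d : nat) (D : set 'rV[R]_d)
    (A : randomized_method D) (df : nat -> 'rV[R]_d -> 'rV[R]_d) (i : nat)
    (w : seed A) : 'rV[R]_d :=
  stage_output (derandomize w) df i.

Definition random_vector (R : realType) (d : nat) (disp : measure_display)
    (T : measurableType disp) (X : T -> 'rV[R]_d) :=
  forall k : 'I_d, measurable_fun [set: T] (fun w => X w 0 k).

(* Main.v *)
(* Fix alpha with alpha^3 = mu^3 eps / (L G)^2 and T of order 1 / alpha. A
   variance-reduced epoch for g_N started at its reference point z, with steps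
   of order 1 / (mu t) and weighted averaging, multiplies the expected squared
   distance to the minimizer by O(L^2 / (mu^2 T)) and reaches an expected gap
   of L^2 |z - x*|^2 / (mu T) up to a constant. A reference point computed at
   stage p from scratch, by three epochs on g_p, is hence within O(alpha G / mu)
   of the minimizer of g_p; minimizers drift by at most 2 G (i - p) / (mu i), so
   it serves every stage i with i - p <= alpha i, where one more epoch on g_i
   gives the accuracy eps and only the gradient of f_i at the reference point
   is missing. A renewal at stage i costs O(i + T) and i exceeds the previous
   renewal by alpha i, so all renewals cost O(n / alpha + n T); the total
   O(n / alpha) is the first term of the bound, and the second is not needed.

   No output depends on the random choices behind an earlier reference point,
   so a stage uses 4 T uniform indices only. They are read off as mixed-radix
   digits of one uniform real, whatever the (unbounded) number of stages. *)
Require Import Defs.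
From HB Require Import structures.
From mathcomp Require Import all_boot all_order all_algebra finmap.
From mathcomp Require Import all_classical all_reals all_analysis.
From mathcomp Require Import ring lra.

Set Implicit Arguments.
Unset Strict Implicit.
Unset Printing Implicit Defensive.

Import Order.TTheory GRing.Theory Num.Theory.
Import numFieldNormedType.Exports.

Local Open Scope classical_set_scope.
Local Open Scope ring_scope.

(** * Euclidean geometry *)

Section Euclidean.
Variables (R : realType) (d : nat).
Implicit Types x y z u v : 'rV[R]_d.

Definition sqn x : R := dot x x.

Lemma dotC x y : dot x y = dot y x.
Proof. by apply: eq_bigr => k _; rewrite mulrC. Qed.

Lemma dotDl x y z : dot (x + y) z = dot x z + dot y z.
Proof. by rewrite -big_split; apply: eq_bigr => k _; rewrite mxE mulrDl. Qed.

Lemma dotZl (a : R) x y : dot (a *: x) y = a * dot x y.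
Proof. by rewrite mulr_sumr; apply: eq_bigr => k _; rewrite mxE mulrA. Qed.

Lemma dotNl x y : dot (- x) y = - dot x y.
Proof. by rewrite -scaleN1r dotZl mulN1r. Qed.

Lemma dotDr x y z : dot x (y + z) = dot x y + dot x z.
Proof. by rewrite dotC dotDl !(dotC _ x). Qed.

Lemma dotZr (a : R) x y : dot x (a *: y) = a * dot x y.
Proof. by rewrite dotC dotZl dotC. Qed.

Lemma dotNr x y : dot x (- y) = - dot x y.
Proof. by rewrite dotC dotNl dotC. Qed.

Definition dotE := (dotDl, dotDr, dotNl, dotNr, dotZl, dotZr).

Lemma dot_suml (I : Type) (r : seq I) (F : I -> 'rV[R]_d) y :
  dot (\sum_(j <- r) F j) y = \sum_(j <- r) dot (F j) y.
Proof.
elim/big_ind2: _ => [|? u ? v <- <-|//]; last exact: dotDl.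
by rewrite -(scale0r 0) dotZl mul0r.
Qed.

Lemma sqn_ge0 x : 0 <= sqn x.
Proof. by apply: sumr_ge0 => k _; rewrite -expr2 sqr_ge0. Qed.

Lemma enorm_ge0 x : 0 <= enorm x.
Proof. exact: sqrtr_ge0. Qed.

Lemma enorm_sqr x : enorm x ^+ 2 = sqn x.
Proof. by rewrite sqr_sqrtr ?sqn_ge0. Qed.

Lemma sqnN x : sqn (- x) = sqn x.
Proof. by rewrite /sqn !dotE opprK. Qed.

Lemma sqnB x y : sqn (x - y) = sqn (y - x).
Proof. by rewrite -sqnN opprB. Qed.

Lemma sqnD_le x y : sqn (x + y) <= 2 * sqn x + 2 * sqn y.
Proof.
by have := sqn_ge0 (x - y); rewrite /sqn !dotE (dotC y x); lra.
Qed.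

Lemma norm_entry_le x k : `|x 0 k| <= `|x|.
Proof.
rewrite [leRHS]/Num.Def.normr /= mx_normrE.
exact: (le_bigmax _ (fun i : 'I_1 * 'I_d => `|x i.1 i.2|) (0, k)).
Qed.

(** The topology of ['rV[R]_d] comes from the sup norm; this comparison turns Euclidean Lipschitz
    bounds into continuity. *)
Lemma enorm_le_norm x : enorm x <= d%:R * `|x|.
Proof.
have d0 : 0 <= d%:R :> R by [].
rewrite -(@ler_pXn2r _ 2) ?nnegrE ?enorm_ge0 ?mulr_ge0 // enorm_sqr exprMn.
apply: (@le_trans _ _ (d%:R * `|x| ^+ 2)).
  rewrite mulr_natl -[leRHS]/(_ *+ _) -[X in _ *+ X]card_ord -sumr_const.
  apply: ler_sum => k _.
  rewrite -expr2 -real_normK ?num_real //.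
  by rewrite lerXn2r ?nnegrE // norm_entry_le.
by rewrite ler_wpM2r ?sqr_ge0 // -natrX ler_nat; case: (d) => // n; rewrite leq_pmulr.
Qed.

Lemma convex_set_segment (D : set 'rV[R]_d) x y (t : R) :
  convex_set D -> D x -> D y -> 0 <= t -> t <= 1 -> D (x + t *: (y - x)).
Proof.
move=> cD Dx Dy t0 t1.
have := cD y x (Itv01 t0 t1); rewrite !inE => /(_ Dy Dx).
rewrite [X in D X -> _](_ : _ = t *: y + (1 - t) *: x) //.
by rewrite scalerBr scalerBl scale1r addrCA addrA.
Qed.

End Euclidean.

(** * Minimizers and projection on a convex compact set *)

Section Projection.
Variables (R : realType) (d : nat) (D : set 'rV[R]_d).
Hypotheses (D0 : D !=set0) (cD : convex_set D) (kD : compact D).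

Lemma lipschitz_continuous_within (C : R) (g : 'rV[R]_d -> R) :
  (forall x y, D x -> D y -> `|g x - g y| <= C * enorm (x - y)) ->
  {within D, continuous g}.
Proof.
move=> gC; apply/subspace_continuousP => x Dx; apply/cvgrPdist_le => e e0.
(* [C] has no sign and [d] may be 0; the added ones keep [c] positive. *)
rewrite near_withinE; pose c := (1 + `|C|) * (1 + d%:R).
have c0 : 0 < c by rewrite mulr_gt0 // ltr_wpDr.
near=> y => Dy; apply: le_trans (gC _ _ Dx Dy) _.
apply: (@le_trans _ _ (c * `|x - y|)).
  have C1 : C <= 1 + `|C| by rewrite ler_wpDl ?ler_norm.
  apply: (@le_trans _ _ ((1 + `|C|) * enorm (x - y))).
    by rewrite ler_wpM2r ?enorm_ge0.
  rewrite -mulrA ler_wpM2l ?addr_ge0 // (le_trans (enorm_le_norm _)) //.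
  by rewrite ler_wpM2r // ler_wpDl.
rewrite -ler_pdivlMl // mulrC; near: y.
apply: cvgr_dist_le => //; rewrite divr_gt0 //.
Unshelve. all: by end_near. Qed.

Lemma exists_argmin (g : 'rV[R]_d -> R) :
  {within D, continuous g} -> exists x, is_argmin D g x.
Proof.
move=> cg; have [c /[!inE] Dc minc] := EVT_min_rV D0 kD cg.
by exists c; split=> // y Dy; apply: minc; rewrite inE.
Qed.

Lemma sqn_continuous (z : 'rV[R]_d) :
  continuous (fun y : 'rV[R]_d => sqn (z - y)).
Proof.
apply: continuous_big => [|k _ y]; first exact: add_continuous.
suff H : continuous (fun y : 'rV[R]_d => (z - y) 0 k) by exact: cvgM (H y) (H y).
move=> x; rewrite (_ : (fun y => _) = fun y : 'rV[R]_d => z 0 k - y 0 k).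
  exact: (cvgB (cvg_cst _) (@coord_continuous R 1 d 0 k x)).
by apply/funext => v; rewrite !mxE.
Qed.

(** Euclidean projection; [projP] rules out the default 0 of [xget] by compactness. *)
Definition proj (z : 'rV[R]_d) : 'rV[R]_d :=
  xget 0 [set p | is_argmin D (fun y => sqn (z - y)) p].

Lemma projP z : is_argmin D (fun y => sqn (z - y)) (proj z).
Proof.
have [p ?] := exists_argmin (continuous_subspaceT (@sqn_continuous z)).
exact: (@xgetPex _ 0 [set p | is_argmin D (fun y => sqn (z - y)) p]) (ex_intro _ p _).
Qed.

Lemma proj_in z : D (proj z).
Proof. by have [] := projP z. Qed.

(** Stands for the limit [t] to 0 in optimality arguments: for positive [a], the value
    [t = a / (2 * b)] gives a contradiction, and it is at most 1 because the case [t = 1] reads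
    [a <= b]. *)
Lemma linear_le0 (a b : R) :
  (forall t, 0 < t -> t <= 1 -> a <= t * b) -> a <= 0.
Proof.
move=> H; rewrite leNgt; apply/negP => a0.
have b0 : 0 < b by have := H 1 ltr01 (lexx 1); rewrite mul1r => /(lt_le_trans a0).
pose t := a / (2 * b).
have ab : a <= b by have := H 1 ltr01 (lexx 1); rewrite mul1r.
have : a <= t * b.
  apply: H; first by rewrite divr_gt0 ?mulr_gt0.
  by rewrite ler_pdivrMr ?mulr_gt0 // mul1r; lra.
rewrite (_ : t * b = a / 2); first by lra.
by rewrite /t; field; rewrite gt_eqF.
Qed.

(** Compare [proj z] with the points of the segment to [y], divide by [t] and let [t] vanish. *)
Lemma proj_obtuse z y : D y -> dot (z - proj z) (y - proj z) <= 0.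
Proof.
move=> Dy; have [Dp minp] := projP z.
apply: (@linear_le0 _ (sqn (y - proj z) / 2)) => t t0 t1.
have := minp _ (convex_set_segment cD Dp Dy (ltW t0) t1).
rewrite opprD addrA /sqn; move: (z - proj z) (y - proj z) => u v.
rewrite !dotE (dotC v u) => H.
have {}H : t * (2 * dot u v - t * dot v v) <= 0 by lra.
by move: H; rewrite pmulr_rle0 //; lra.
Qed.

End Projection.

(** Quadratic growth without first-order optimality: strong convexity at a point [w] of the segment,
    towards both ends and with weights [t] and [1 - t], cancels the gradient at [w]; minimality of
    [x] then leaves a factor [t] to divide by. *)
Lemma argmin_strong (R : realType) d (D : set 'rV[R]_d) (g : 'rV[R]_d -> R)
    (dg : 'rV[R]_d -> 'rV[R]_d) (mu : R) x y :
  convex_set D -> 0 <= mu ->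
  (forall x y, D x -> D y ->
     g y + dot (dg y) (x - y) + mu / 2 * sqn (x - y) <= g x) ->
  is_argmin D g x -> D y -> mu / 2 * sqn (y - x) <= g y - g x.
Proof.
move=> cD mu0 scg [Dx minx] Dy; rewrite -subr_le0.
apply: (@linear_le0 _ _ (mu / 2 * sqn (y - x))) => t t0 t1.
set w := x + t *: (y - x).
have Dw : D w by apply: convex_set_segment => //; exact: ltW.
have := minx _ Dw; have := scg _ _ Dx Dw; have := scg _ _ Dy Dw.
have -> : y - w = (1 - t) *: (y - x).
  by rewrite /w scalerBl scale1r opprD addrA.
have -> : x - w = - t *: (y - x) by rewrite /w opprD addrA subrr sub0r scaleNr.
rewrite /sqn !(dotZl, dotZr).
move: (dot (dg w) (y - x)) (dot (y - x) (y - x)) => a b H1 H2 H3.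
have t1' : 0 <= 1 - t by lra.
have H4 := ler_wpM2l t1' H2.
have H5 := ler_wpM2l (ltW t0) H1.
have {}H4 : t * (g x - g y + mu / 2 * (1 - t) * b) <= 0 by lra.
by move: H4; rewrite pmulr_rle0 //; lra.
Qed.

(** * One variance-reduced step *)

Section Mean.
Variable R : realType.
Implicit Types (N : nat) (F H : nat -> R).

Definition mean N F : R := N%:R^-1 * \sum_(1 <= j < N.+1) F j.

Lemma eq_mean N F H :
  (forall j, (1 <= j <= N)%N -> F j = H j) -> mean N F = mean N H.
Proof. by move=> FH; congr (_ * _); apply: eq_big_nat => j /FH. Qed.

Lemma ler_mean N F H :
  (forall j, (1 <= j <= N)%N -> F j <= H j) -> mean N F <= mean N H.
Proof.
by move=> FH; rewrite ler_wpM2l ?invr_ge0 //; apply: ler_sum_nat => j /FH.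
Qed.

Lemma meanD N F H : mean N (fun j => F j + H j) = mean N F + mean N H.
Proof. by rewrite /mean big_split mulrDr. Qed.

Lemma meanZ N (a : R) F : mean N (fun j => a * F j) = a * mean N F.
Proof. by rewrite /mean -mulr_sumr mulrCA. Qed.

Lemma mean_cst N (a : R) : (0 < N)%N -> mean N (fun=> a) = a.
Proof.
move=> N0; rewrite /mean big_const_nat iter_addr_0 subSS subn0.
by rewrite mulrC -[a *+ N]mulr_natr mulfK // pnatr_eq0 -lt0n.
Qed.

Variable d : nat.

Definition vmean N (X : nat -> 'rV[R]_d) : 'rV[R]_d :=
  N%:R^-1 *: \sum_(1 <= j < N.+1) X j.

Lemma dot_vmean N X y : dot (vmean N X) y = mean N (fun j => dot (X j) y).
Proof. by rewrite dotZl dot_suml. Qed.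

Lemma vmeanB N X Y : vmean N (fun j => X j - Y j) = vmean N X - vmean N Y.
Proof. by rewrite /vmean sumrB scalerBr. Qed.

Lemma mean_dot_centered N X y :
  (0 < N)%N -> mean N (fun j => dot (X j - vmean N X) y) = 0.
Proof.
move=> N0; under eq_mean do rewrite dotDl dotNl.
by rewrite meanD mean_cst // dot_vmean subrr.
Qed.

(** Expanding the square, the variance is the second moment minus [sqn m]. *)
Lemma mean_sqn_centered N X : (0 < N)%N ->
  mean N (fun j => sqn (X j - vmean N X)) <= mean N (fun j => sqn (X j)).
Proof.
move=> N0; set m := vmean N X.
rewrite (@eq_mean _ _ (fun j => sqn (X j) + (- 2 * dot (X j) m + sqn m))).
  rewrite meanD gerDl meanD meanZ mean_cst // -dot_vmean -/m /sqn.
  by have := sqn_ge0 m; rewrite /sqn; lra.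
by move=> j _; rewrite /sqn; move: m (X j) => m x; rewrite !dotE (dotC m x); lra.
Qed.

End Mean.

(* Convexity at [p] replaces the usual integral argument, at the price of the
   constant [L] instead of [L / 2]; no derivative of [f] is involved. *)
Lemma admissible_descent (R : realType) d (D : set 'rV[R]_d) (mu L G : R)
    f df x p :
  0 <= mu -> 0 < L -> admissible D mu L G f df -> D x -> D p ->
  f p <= f x + dot (df x) (p - x) + L * sqn (p - x).
Proof.
move=> mu0 L0 [_ sc _ _ smooth] Dx Dp.
have := sc _ _ Dx Dp; rewrite enorm_sqr.
have : sqn (df p - df x) <= L ^+ 2 * sqn (p - x).
  rewrite -!enorm_sqr -exprMn lerXn2r ?nnegrE ?enorm_ge0 ?smooth //.
  by rewrite mulr_ge0 ?enorm_ge0 // ltW.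
have -> : x - p = - (p - x) by rewrite opprB.
move: (df p) (df x) (p - x) => q r h.
have q0 : 0 <= mu / 2 * sqn (- h) by rewrite mulr_ge0 ?sqn_ge0 // divr_ge0.
have := sqn_ge0 (L *: h - (q - r)); rewrite /sqn in q0 *; rewrite !dotE in q0 *.
rewrite !(dotC h) => H1 H2 H3.
rewrite -subr_ge0 -(pmulr_rge0 _ L0); nra.
Qed.

Section SVRGStep.
Variables (R : realType) (d : nat) (D : set 'rV[R]_d).
Hypotheses (D0 : D !=set0) (cD : convex_set D) (kD : compact D).
Variables (mu L G : R) (N : nat).
Variables (f : nat -> 'rV[R]_d -> R) (df : nat -> 'rV[R]_d -> 'rV[R]_d).
Hypotheses (mu0 : 0 < mu) (L0 : 0 < L) (N0 : (0 < N)%N).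
Hypothesis adm :
  forall j, (1 <= j <= N)%N -> admissible D mu L G (f j) (df j).

Let g := prefix_mean f N.
Let dg x := vmean N (fun j => df j x).

Lemma prefix_mean_strongly_convex x y : D x -> D y ->
  g y + dot (dg y) (x - y) + mu / 2 * sqn (x - y) <= g x.
Proof.
move=> Dx Dy; rewrite -(mean_cst (_ * sqn _) N0) dot_vmean -!meanD.
by apply: ler_mean => j /adm[_ sc _ _ _]; rewrite -enorm_sqr sc.
Qed.

Lemma prefix_mean_convex x y : D x -> D y -> g y + dot (dg y) (x - y) <= g x.
Proof.
move=> Dx Dy; apply: le_trans (prefix_mean_strongly_convex Dx Dy).
by rewrite lerDl mulr_ge0 ?sqn_ge0 // divr_ge0 // ltW.
Qed.

Lemma prefix_mean_descent x p : D x -> D p ->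
  g p <= g x + dot (dg x) (p - x) + L * sqn (p - x).
Proof.
move=> Dx Dp; rewrite -(mean_cst (L * _) N0) dot_vmean -!meanD.
by apply: ler_mean => j /adm; move/admissible_descent; apply => //; exact: ltW.
Qed.

Lemma prefix_mean_lipschitz x y : D x -> D y -> `|g x - g y| <= G * enorm (x - y).
Proof.
move=> Dx Dy.
have le j : (1 <= j <= N)%N -> f j x <= f j y + G * enorm (x - y).
  by move=> /adm[_ _ /(_ _ _ Dx Dy) /ler_normlW + _ _]; rewrite lerBlDl.
have ge j : (1 <= j <= N)%N -> f j y <= f j x + G * enorm (x - y).
  move=> /adm[_ _ /(_ _ _ Dx Dy)].
  by rewrite distrC => /ler_normlW + _ _; rewrite lerBlDl.
have := ler_mean le; have := ler_mean ge; rewrite !meanD !mean_cst //.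
rewrite -[mean N (fun j => f j x)]/(g x) -[mean N (fun j => f j y)]/(g y).
by move=> H1 H2; rewrite ler_norml; apply/andP; split; lra.
Qed.

(** The oracle [O] is a parameter: the analysis takes [df], the method takes the answers recorded so
    far. *)
Definition vr_gradient (O : nat -> 'rV[R]_d -> 'rV[R]_d) z j x :=
  O j x - O j z + vmean N (fun k => O k z).

(** Combines the obtuse angle at [p], the descent bound from [x] to [p] and strong convexity from
    [x] to [y]. *)
Lemma prox_step (gamma : R) x y v (p := proj D (x - gamma *: v)) :
  0 < gamma -> 4 * gamma * L <= 1 -> D x -> D y ->
  sqn (p - y) + 2 * gamma * (g p - g y) <=
    (1 - gamma * mu) * sqn (x - y) - 2 * gamma * dot (v - dg x) (x - y)
    + 2 * gamma ^+ 2 * sqn (v - dg x).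
Proof.
move=> ga0 gaL Dx Dy; have Dp : D p by exact: proj_in.
have := proj_obtuse D0 cD kD (x - gamma *: v) Dy; rewrite -/p.
have := prefix_mean_strongly_convex Dy Dx; have := prefix_mean_descent Dx Dp.
have -> : x - gamma *: v - p = - (p - x) - gamma *: v.
  by rewrite opprB addrAC.
have -> : y - p = - (p - x) - (x - y) by rewrite !opprB [RHS]addrC addrA subrK.
have -> : y - x = - (x - y) by rewrite opprB.
have -> : p - y = (p - x) + (x - y) by rewrite addrA subrK.
have gaL' : gamma * (4 * L) <= 1 by lra.
move: (g p) (g y) (g x) (dg x) (p - x) (x - y) => gp gy gx q b a.
have bb := sqn_ge0 b.
(* Young's inequality for the gradient error against [b = p - x]: half of [sqn b] pays for it, the
   other half for the descent term since [4 * gamma * L <= 1]. *)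
have := sqn_ge0 ((2 * gamma) *: (v - q) + b).
rewrite /sqn in bb *; rewrite !dotE !(dotC b) !(dotC a) !(dotC q v).
move: (dot a a) (dot b b) (dot v v) (dot q q) (dot v q) (dot v a) (dot v b)
  (dot q a) (dot q b) (dot a b) bb => aa bb vv qq vq va vb qa qb ab bb0.
move=> Y H1 H2 H3.
have := ler_wpM2l (ltW ga0) H1; have := ler_wpM2l (ltW ga0) H2.
have := ler_wpM2r bb0 gaL'.
lra.
Qed.

(** Averaged over [j], the linear error vanishes and the variance is at most [L ^+ 2 * sqn (x - z)].
    Its part in [sqn (x - y)] costs half of the contraction, by the third condition on [gamma]. *)
Lemma svrg_step (gamma : R) x y z
    (p := fun j => proj D (x - gamma *: vr_gradient df z j x)) :
  0 < gamma -> 4 * gamma * L <= 1 -> 8 * gamma * L ^+ 2 <= mu ->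
  D x -> D y -> D z ->
  mean N (fun j => sqn (p j - y) + 2 * gamma * (g (p j) - g y)) <=
    (1 - gamma * mu / 2) * sqn (x - y)
    + 4 * gamma ^+ 2 * L ^+ 2 * sqn (z - y).
Proof.
move=> ga0 gaL gamu Dx Dy Dz.
apply: le_trans (ler_mean (fun j _ => prox_step _ ga0 gaL Dx Dy)) _.
pose X j := df j x - df j z.
have vE j : vr_gradient df z j x - dg x = X j - vmean N X.
  by rewrite /vr_gradient /X vmeanB -/(dg x) opprB addrA.
under eq_mean do rewrite vE.
rewrite 2!meanD mean_cst // meanZ.
under [X in _ + X + _]eq_mean do rewrite -mulNr.
rewrite meanZ mean_dot_centered // mulr0 addr0.
have XL : mean N (fun j => sqn (X j)) <= L ^+ 2 * sqn (x - z).
  rewrite -(mean_cst (L ^+ 2 * _) N0); apply: ler_mean => j /adm[_ _ _ _ smooth].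
  rewrite -!enorm_sqr -exprMn lerXn2r ?nnegrE ?enorm_ge0 ?smooth //.
  by rewrite mulr_ge0 ?enorm_ge0 // ltW.
have xzy : sqn (x - z) <= 2 * sqn (x - y) + 2 * sqn (z - y).
  have -> : x - z = (x - y) + (y - z) by rewrite addrA subrK.
  by rewrite (le_trans (sqnD_le _ _)) // (sqnB y).
have XX := le_trans (mean_sqn_centered X N0) XL.
have a0 := sqn_ge0 (x - y).
have ga2 : 0 <= 2 * gamma ^+ 2 by rewrite mulr_ge0 ?sqr_ge0.
have := ler_wpM2l ga2 (le_trans XX (ler_wpM2l (sqr_ge0 L) xzy)).
have := ler_wpM2l (mulr_ge0 (ltW ga0) a0) gamu.
lra.
Qed.

End SVRGStep.

(** * One epoch *)

Section Average.
Variable R : realType.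
Implicit Types (b sigma : nat -> nat) (S k j : nat) (F H : (nat -> nat) -> R).

Definition upd sigma k j : nat -> nat := fun i => if i == k then j else sigma i.

(* Expectation over independent digits, the k-th one uniform on 1, ..., b k. *)
Fixpoint avg b S F : R :=
  if S is s.+1 then avg b s (fun sigma => mean (b s) (fun j => F (upd sigma s j)))
  else F (fun=> 0%N).

Lemma eq_avg b S F H : F =1 H -> avg b S F = avg b S H.
Proof. by move=> /funext ->. Qed.

Lemma ler_avg b S F H : (forall sigma, F sigma <= H sigma) -> avg b S F <= avg b S H.
Proof.
elim: S F H => [|S IH] F H FH /=; first exact: FH.
by apply: IH => sigma; apply: ler_mean => j _; exact: FH.
Qed.

Lemma avgD b S F H : avg b S (fun sigma => F sigma + H sigma) = avg b S F + avg b S H.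
Proof.
elim: S F H => //= S IH F H; rewrite -IH; apply: eq_avg => sigma.
exact: meanD.
Qed.

Lemma avgZ b S (a : R) F : avg b S (fun sigma => a * F sigma) = a * avg b S F.
Proof.
elim: S F => //= S IH F; rewrite -IH; apply: eq_avg => sigma.
exact: meanZ.
Qed.

(** Discrete form of measurability with respect to the first [k] digits. *)
Definition past_only (U : Type) k (X : (nat -> nat) -> U) :=
  forall sigma sigma', (forall i, (i < k)%N -> sigma i = sigma' i) ->
  X sigma = X sigma'.

Lemma upd_past sigma k l j i : (k <= l)%N -> (i < k)%N -> upd sigma l j i = sigma i.
Proof. by move=> kl ik; rewrite /upd ltn_eqF // (leq_trans ik). Qed.

(** Later digits integrate out one by one, the mean of a constant being that constant when the radix
    is positive. *)
Lemma avg_past b k t F : (forall i, (0 < b i)%N) -> past_only k F ->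
  avg b (k + t) F = avg b k F.
Proof.
move=> b0 kF; elim: t => [|t IH]; first by rewrite addn0.
rewrite addnS /= -{}IH; apply: eq_avg => sigma.
rewrite -[RHS](mean_cst _ (b0 (k + t)%N)); apply: eq_mean => j _.
by apply: kF => i ik; rewrite (@upd_past _ k) ?leq_addr.
Qed.

Lemma avg_cst b S (a : R) : (forall i, (0 < b i)%N) -> avg b S (fun=> a) = a.
Proof. by move=> b0; rewrite -[S]add0n avg_past. Qed.

End Average.

Section Epoch.
Variables (R : realType) (d : nat) (D : set 'rV[R]_d).
Variables (mu : R) (K : nat).

(** The offset [K] makes even the first step short enough for [svrg_step]; the factor 4 makes the
    contraction [1 - 2 / weight t]. *)
Definition step_size t : R := 4 / (mu * (K + t)%:R).

Definition weight t : R := (K + t)%:R.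

Definition total_weight t : R := \sum_(0 <= s < t) weight s.

Lemma total_weightS t : total_weight t.+1 = total_weight t + weight t.
Proof. by rewrite /total_weight big_nat_recr. Qed.

Lemma total_weight_ge0 t : 0 <= total_weight t.
Proof. exact: sumr_ge0. Qed.

Lemma total_weight_ge t : (0 < K)%N -> t%:R ^+ 2 <= 2 * total_weight t.
Proof.
move=> K0; have K1 : 1 <= K%:R :> R by rewrite ler1n.
elim: t => [|t IH]; first by rewrite /total_weight big_geq // expr0n mulr0.
rewrite total_weightS /weight natrD -natr1; have : 0 <= t%:R :> R by [].
nra.
Qed.

Definition sgd_step N (O : nat -> 'rV[R]_d -> 'rV[R]_d) z t j
    (s : 'rV[R]_d * 'rV[R]_d) : 'rV[R]_d * 'rV[R]_d :=
  let x := proj D (s.1 - step_size t *: vr_gradient N O z j s.1) in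
  (x, s.2 + (weight t / total_weight t.+1) *: (x - s.2)).

(* Current iterate and weighted average of the iterates after [t] steps. *)
Fixpoint sgd N (O : nat -> 'rV[R]_d -> 'rV[R]_d) z (sigma : nat -> nat) t :
    'rV[R]_d * 'rV[R]_d :=
  if t is s.+1 then sgd_step N O z s (sigma s) (sgd N O z sigma s) else (z, z).

Hypotheses (D0 : D !=set0) (cD : convex_set D) (kD : compact D).
Hypothesis K0 : (0 < K)%N.

Lemma total_weight_gt0 t : 0 < total_weight t.+1.
Proof.
rewrite total_weightS ltr_wpDl ?total_weight_ge0 // ltr0n.
by rewrite (leq_trans K0) ?leq_addr.
Qed.

Lemma weight_ratio t : 0 <= weight t / total_weight t.+1 <= 1.
Proof.
have W0 := total_weight_gt0 t; have w0 : 0 <= weight t by [].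
rewrite divr_ge0 ?(ltW W0) //= ler_pdivrMr // mul1r total_weightS.
by rewrite lerDr total_weight_ge0.
Qed.

Lemma sgd_step_in N O z t j s :
  D s.1 -> D s.2 -> D (sgd_step N O z t j s).1 /\ D (sgd_step N O z t j s).2.
Proof.
move=> Ds1 Ds2; have Dx := proj_in D0 kD; split; first exact: Dx.
by have /andP[? ?] := weight_ratio t; apply: convex_set_segment.
Qed.

Lemma sgd_in N O z sigma t :
  D z -> D (sgd N O z sigma t).1 /\ D (sgd N O z sigma t).2.
Proof.
by move=> Dz; elim: t => //= t [? ?]; apply: sgd_step_in.
Qed.

Lemma eq_sgd N O z sigma sigma' t :
  (forall s, (s < t)%N -> sigma s = sigma' s) ->
  sgd N O z sigma t = sgd N O z sigma' t.
Proof.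
elim: t => //= t IH H; rewrite H // IH // => s st; apply: H.
exact: ltnW.
Qed.

Variables (L G : R) (N : nat).
Variables (f : nat -> 'rV[R]_d -> R) (df : nat -> 'rV[R]_d -> 'rV[R]_d).
Hypotheses (mu0 : 0 < mu) (L0 : 0 < L) (N0 : (0 < N)%N).
Hypotheses (KL : 16 * L <= mu * K%:R) (KL2 : 32 * L ^+ 2 <= mu ^+ 2 * K%:R).
Hypothesis adm :
  forall j, (1 <= j <= N)%N -> admissible D mu L G (f j) (df j).

Let g := prefix_mean f N.

Lemma prefix_mean_segment x y (t : R) : D x -> D y -> 0 <= t <= 1 ->
  g (x + t *: (y - x)) <= (1 - t) * g x + t * g y.
Proof.
move=> Dx Dy /andP[t0 t1]; set w := x + _.
have Dw : D w by apply: convex_set_segment.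
have := prefix_mean_convex mu0 N0 adm Dx Dw.
have := prefix_mean_convex mu0 N0 adm Dy Dw.
have -> : y - w = (1 - t) *: (y - x).
  by rewrite /w scalerBl scale1r opprD addrA.
have -> : x - w = - t *: (y - x) by rewrite /w opprD addrA subrr sub0r scaleNr.
rewrite !dotZr -/g; move: (dot _ _) => q H1 H2.
have t1' : 0 <= 1 - t by lra.
have := ler_wpM2l t1' H2; have := ler_wpM2l t0 H1; lra.
Qed.

(** Lyapunov function of the epoch. With [w = weight t], its distance coefficients telescope because
    [w ^+ 2 * (1 - 2 / w) <= (w - 1) ^+ 2]. *)
Definition potential y t (s : 'rV[R]_d * 'rV[R]_d) : R :=
  mu / 4 * (K%:R + t%:R - 1) ^+ 2 * sqn (s.1 - y)
  + 2 * total_weight t * (g s.2 - g y).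

Lemma potential_step y z t s : D y -> D z -> D s.1 -> D s.2 ->
  mean N (fun j => potential y t.+1 (sgd_step N df z t j s)) <=
    potential y t s + 16 * L ^+ 2 / mu * sqn (z - y).
Proof.
move=> Dy Dz Ds1 Ds2; set ga := step_size t; set w := weight t.
have K1 : 1 <= K%:R :> R by rewrite ler1n.
have t0 : 0 <= t%:R :> R by [].
have wE : w = K%:R + t%:R by rewrite /w /weight natrD.
have w0 : 0 < w by lra.
have muw : 0 < mu * w by rewrite mulr_gt0.
(* All constants below come from this product. *)
have gaE : ga * (mu * w) = 4 by rewrite divfK ?gt_eqF.
have ga0 : 0 < ga by rewrite divr_gt0.
have mut : 0 <= mu * t%:R by rewrite mulr_ge0 // ltW.
have mumut : 0 <= mu ^+ 2 * t%:R by rewrite mulr_ge0 ?sqr_ge0.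
have gaL : 4 * ga * L <= 1.
  rewrite -(ler_pM2r muw) (_ : 4 * ga * L * (mu * w) = 4 * L * (ga * (mu * w)));
    last by ring.
  by rewrite gaE wE; have := KL; lra.
have gamu : 8 * ga * L ^+ 2 <= mu.
  rewrite -(ler_pM2r muw).
  rewrite (_ : 8 * ga * L ^+ 2 * (mu * w) = 8 * L ^+ 2 * (ga * (mu * w))); last by ring.
  by rewrite gaE wE; have := KL2; lra.
pose p j := proj D (s.1 - ga *: vr_gradient N df z j s.1).
have H : mean N (fun j => sqn (p j - y) + 2 * ga * (g (p j) - g y)) <=
    (1 - ga * mu / 2) * sqn (s.1 - y) + 4 * ga ^+ 2 * L ^+ 2 * sqn (z - y).
  exact: (svrg_step D0 cD kD mu0 L0 N0 adm).
have c0 : 0 <= mu * w ^+ 2 / 4 by rewrite divr_ge0 // mulr_ge0 ?sqr_ge0 // ltW.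
pose C := 2 * total_weight t * (g s.2 - g y).
(* The factor [mu * w ^+ 2 / 4] turns the gap coefficient [2 * ga] into [2 * w], the weight that
   convexity gives the new iterate in the average. *)
apply: (@le_trans _ _ (mean N (fun j => mu * w ^+ 2 / 4 *
   (sqn (p j - y) + 2 * ga * (g (p j) - g y)) + C))).
  apply: ler_mean => j _; rewrite /potential /= -/(p j).
  have Dp : D (p j) by exact: proj_in.
  have := prefix_mean_segment Ds2 Dp (weight_ratio t).
  set th := weight t / _ => Hc.
  have W0 := total_weight_gt0 t.
  have thW : total_weight t.+1 * th = w.
    by rewrite /th mulrC divfK // gt_eqF.
  have := ler_wpM2l (ltW W0) Hc.
  have -> : total_weight t.+1 * ((1 - th) * g s.2 + th * g (p j)) =
    (total_weight t.+1 - total_weight t.+1 * th) * g s.2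
    + (total_weight t.+1 * th) * g (p j) by lra.
  rewrite thW /C total_weightS -/w addrK.
  have -> : K%:R + t.+1%:R - 1 = w by rewrite wE -natr1; lra.
  have -> : mu * w ^+ 2 / 4 * (sqn (p j - y) + 2 * ga * (g (p j) - g y)) =
    mu / 4 * w ^+ 2 * sqn (p j - y) + ga * (mu * w) * w / 2 * (g (p j) - g y).
    by field.
  rewrite gaE; lra.
rewrite meanD mean_cst // meanZ; have := ler_wpM2l c0 H.
rewrite /potential -/C.
have -> : mu * w ^+ 2 / 4 * ((1 - ga * mu / 2) * sqn (s.1 - y) +
    4 * ga ^+ 2 * L ^+ 2 * sqn (z - y)) =
  (mu * w ^+ 2 / 4 - ga * (mu * w) * mu * w / 8) * sqn (s.1 - y) +
  (ga * (mu * w)) ^+ 2 * L ^+ 2 / mu * sqn (z - y).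
  by field; rewrite gt_eqF.
rewrite gaE -wE (_ : 4 ^+ 2 * L ^+ 2 = 16 * L ^+ 2); last by ring.
move=> H'.
have a0 := sqn_ge0 (s.1 - y).
have := mulr_ge0 (ltW mu0) a0.
lra.
Qed.

Variables (b : nat -> nat) (k : nat) (z : (nat -> nat) -> 'rV[R]_d).
Hypotheses (b0 : forall i, (0 < b i)%N) (kz : past_only k z).
Hypothesis Dz : forall sigma, D (z sigma).

(** Sums [potential_step] over the epoch. The reference point depends on the first [k] digits only,
    so every step adds the same error term. *)
Lemma avg_potential y T : D y -> (forall t, (t < T)%N -> b (k + t) = N) ->
  avg b (k + T)
    (fun sigma => potential y T (sgd N df (z sigma) (fun s => sigma (k + s)%N) T))
  <= (mu / 4 * (K%:R - 1) ^+ 2 + T%:R * (16 * L ^+ 2 / mu))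
     * avg b k (fun sigma => sqn (z sigma - y)).
Proof.
move=> Dy bN; rewrite -avgZ.
elim: T bN => [|T IH] bN.
  rewrite addn0; apply: ler_avg => sigma.
  by rewrite /potential /total_weight big_geq //= mulr0n mulr0 !mul0r !addr0.
have := IH (fun t tT => bN t (ltnW tT)).
rewrite addnS /= bN // => {}IH.
pose A sigma := 16 * L ^+ 2 / mu * sqn (z sigma - y).
rewrite [leRHS](_ : _ = avg b k (fun sigma => (mu / 4 * (K%:R - 1) ^+ 2 +
    T%:R * (16 * L ^+ 2 / mu)) * sqn (z sigma - y)) + avg b k A); last first.
  by rewrite -avgD; apply: eq_avg => sigma; rewrite /A -natr1; ring.
have -> : avg b k A = avg b (k + T) A.
  by rewrite avg_past // => sigma sigma' E; rewrite /A (kz E).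
apply: le_trans (lerD IH (lexx _)).
rewrite -avgD; apply: ler_avg => sigma; rewrite /A.
have [Ds1 Ds2] := sgd_in N df (fun s => sigma (k + s)%N) T (Dz sigma).
apply: le_trans (potential_step T Dy (Dz sigma) Ds1 Ds2).
apply: ler_mean => j _.
have -> : z (upd sigma (k + T) j) = z sigma.
  by apply: kz => i ik; rewrite (@upd_past _ k) ?leq_addr.
rewrite (@eq_sgd N df _ _ (fun s => sigma (k + s)%N) T); last first.
  by move=> s sT; rewrite (@upd_past _ (k + T)) // ltn_add2l.
by rewrite /upd eqxx.
Qed.

Lemma epoch_gap y T : D y -> (0 < T)%N ->
  mu ^+ 2 * K%:R ^+ 2 <= 4 * L ^+ 2 * T%:R ->
  (forall t, (t < T)%N -> b (k + t) = N) ->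
  avg b (k + T)
    (fun sigma => g (sgd N df (z sigma) (fun s => sigma (k + s)%N) T).2 - g y)
  <= 17 * L ^+ 2 / (mu * T%:R) * avg b k (fun sigma => sqn (z sigma - y)).
Proof.
move=> Dy T0 KT bN.
have := avg_potential Dy bN.
set E := avg b k _.
set A := (X in _ -> X <= _) => H.
have E0 : 0 <= E.
  by rewrite -(avg_cst k 0 b0); apply: ler_avg => sigma; apply: sqn_ge0.
have HA : 2 * total_weight T * A <= 
   (mu / 4 * (K%:R - 1) ^+ 2 + T%:R * (16 * L ^+ 2 / mu)) * E.
  apply: le_trans H; rewrite -avgZ; apply: ler_avg => sigma.
  rewrite lerDr mulr_ge0 ?sqn_ge0 // mulr_ge0 ?sqr_ge0 // divr_ge0 //.
  exact: ltW.
have T0' : 0 < T%:R :> R by rewrite ltr0n.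
have muT : 0 < mu * T%:R by rewrite mulr_gt0.
(* [y] is any point of [D], so the average gap [A] may be negative; [total_weight] can be replaced
   by its lower bound only when [A] is positive. *)
have [A0|A0] := leP A 0.
  apply: le_trans A0 _; rewrite mulr_ge0 // divr_ge0 ?(ltW muT) //.
  by rewrite mulr_ge0 ?sqr_ge0.
have HT : T%:R ^+ 2 * A <= 2 * total_weight T * A.
  by rewrite ler_pM2r // total_weight_ge.
have K1 : 1 <= K%:R :> R by rewrite ler1n.
(* 17 is 16 from the variance plus 1 from the initial distance, bounded through [KT]. *)
have HK : mu / 4 * (K%:R - 1) ^+ 2 + T%:R * (16 * L ^+ 2 / mu) <=
    17 * L ^+ 2 * T%:R / mu.
  rewrite ler_pdivlMr // mulrDl.
  rewrite (_ : T%:R * _ * mu = 16 * L ^+ 2 * T%:R); last by field; rewrite gt_eqF.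
  have : mu ^+ 2 * (K%:R - 1) ^+ 2 <= mu ^+ 2 * K%:R ^+ 2.
    by rewrite ler_wpM2l ?sqr_ge0 // lerXn2r ?nnegrE //; lra.
  have := KT; lra.
have := le_trans HT (le_trans HA (ler_wpM2r E0 HK)).
rewrite [leRHS](_ : _ = T%:R ^+ 2 * (17 * L ^+ 2 / (mu * T%:R) * E)); last first.
  by field; rewrite !gt_eqF.
by rewrite ler_pM2l ?exprn_gt0.
Qed.

End Epoch.

(** * Accuracy of a stage *)

Section Stage.
Variables (R : realType) (d : nat) (D : set 'rV[R]_d).
Variables (mu : R) (K T : nat) (x0 : 'rV[R]_d).
Implicit Types (O : nat -> 'rV[R]_d -> 'rV[R]_d) (N sigma : nat -> nat).

(* Reference point of the e-th epoch, an epoch being run on the N e first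
   functions and started at the output of the previous one. *)
Fixpoint centre O N sigma e : 'rV[R]_d :=
  if e is e'.+1 then
    (sgd D mu K (N e') O (centre O N sigma e') (fun s => sigma (e' * T + s)%N) T).2
  else x0.

Hypotheses (D0 : D !=set0) (cD : convex_set D) (kD : compact D).
Hypotheses (K0 : (0 < K)%N) (T0 : (0 < T)%N) (Dx0 : D x0).

Lemma centre_in O N sigma e : D (centre O N sigma e).
Proof. by elim: e => //= e IH; apply: (sgd_in _ D0 cD kD K0 _ _ _ _ IH).2. Qed.

Lemma eq_centre O N N' sigma sigma' e :
  (forall e', (e' < e)%N -> N e' = N' e') ->
  (forall s, (s < e * T)%N -> sigma s = sigma' s) ->
  centre O N sigma e = centre O N' sigma' e.
Proof.
elim: e => //= e IH HN Hs; rewrite HN // IH.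
- congr (_.2); apply: eq_sgd => s sT; apply: Hs.
  by rewrite mulSn addnC ltn_add2r.
- by move=> e' e'e; apply: HN; exact: ltnW.
- by move=> s se; apply: Hs; rewrite (leq_trans se) // leq_mul2r leqnSn orbT.
Qed.

Lemma centre_past O N e : past_only (e * T) (fun sigma => centre O N sigma e).
Proof. by move=> sigma sigma' E; apply: eq_centre. Qed.

Variables (L G : R) (n : nat).
Variables (f : nat -> 'rV[R]_d -> R) (df : nat -> 'rV[R]_d -> 'rV[R]_d).
Hypotheses (mu0 : 0 < mu) (L0 : 0 < L) (G0 : 0 < G).
Hypotheses (KL : 16 * L <= mu * K%:R) (KL2 : 32 * L ^+ 2 <= mu ^+ 2 * K%:R).
Hypothesis KT : mu ^+ 2 * K%:R ^+ 2 <= 4 * L ^+ 2 * T%:R.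
Hypothesis adm :
  forall j, (1 <= j <= n)%N -> admissible D mu L G (f j) (df j).

Let adm_prefix i : (i <= n)%N ->
  forall j, (1 <= j <= i)%N -> admissible D mu L G (f j) (df j).
Proof. by move=> i_n j /andP[j1 ji]; apply: adm; rewrite j1 (leq_trans ji). Qed.

Lemma prefix_argmin_strong i x y : (0 < i <= n)%N ->
  is_argmin D (prefix_mean f i) x -> D y ->
  mu / 2 * sqn (y - x) <= prefix_mean f i y - prefix_mean f i x.
Proof.
move=> /andP[i0 i_n]; apply: argmin_strong => //; first exact: ltW.
exact: (prefix_mean_strongly_convex i0 (adm_prefix i_n)).
Qed.

Lemma exists_prefix_argmin i : (0 < i <= n)%N ->
  exists x, is_argmin D (prefix_mean f i) x.
Proof.
move=> /andP[i0 i_n]; apply: (exists_argmin D0 kD).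
exact: (lipschitz_continuous_within (prefix_mean_lipschitz i0 (adm_prefix i_n))).
Qed.

Lemma sqn_le_quadratic (c : R) (v : 'rV[R]_d) :
  0 <= c -> mu / 2 * sqn v <= c * enorm v -> sqn v <= (2 * c / mu) ^+ 2.
Proof.
move=> c0; rewrite -enorm_sqr => H; have := enorm_ge0 v.
rewrite le_eqVlt => /predU1P[<-|v0]; first by rewrite expr0n sqr_ge0.
rewrite lerXn2r ?nnegrE ?enorm_ge0 ?divr_ge0 ?mulr_ge0 ?(ltW mu0) //.
rewrite ler_pdivlMr // -(ler_pM2r v0); lra.
Qed.

(** Quadratic growth against the Lipschitz bound; this keeps the diameter of [D] out of the
    complexity. *)
Lemma argmin_diameter i x y : (0 < i <= n)%N ->
  is_argmin D (prefix_mean f i) x -> D y -> sqn (y - x) <= (2 * G / mu) ^+ 2.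
Proof.
move=> i0n xmin Dy; apply: sqn_le_quadratic; first exact: ltW.
apply: le_trans (prefix_argmin_strong i0n xmin Dy) _.
have /andP[i0 i_n] := i0n.
apply: le_trans (ler_norm _) _.
by apply: (prefix_mean_lipschitz i0 (adm_prefix i_n)) => //; case: xmin.
Qed.

(** Of the [i] summands, the first [p] together favour [x], and each of the other [i - p] changes by
    at most [G * enorm (x - y)]; quadratic growth at [y] concludes. *)
Lemma argmin_drift p i x y : (0 < p <= i)%N -> (i <= n)%N ->
  is_argmin D (prefix_mean f p) x -> is_argmin D (prefix_mean f i) y ->
  sqn (x - y) <= (2 * (G * ((i - p)%:R / i%:R)) / mu) ^+ 2.
Proof.
move=> /andP[p0 pi] i_n xmin ymin.
have i0 : (0 < i)%N by rewrite (leq_trans p0).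
have [Dx minx] := xmin; have [Dy _] := ymin.
apply: sqn_le_quadratic.
  by rewrite mulr_ge0 ?divr_ge0 // ltW.
apply: le_trans (prefix_argmin_strong _ ymin Dx) _; first by rewrite i0.
have iR : 0 < i%:R :> R by rewrite ltr0n.
have pR : 0 < p%:R :> R by rewrite ltr0n.
have sumE k z : (0 < k)%N ->
    k%:R * prefix_mean f k z = \sum_(1 <= j < k.+1) f j z.
  by move=> k0; rewrite mulrA mulfV ?mul1r // pnatr_eq0 -lt0n.
rewrite -(ler_pM2l iR) mulrBr !sumE // -sumrB (@big_cat_nat _ _ _ p.+1) //=.
rewrite [X in X + _](_ : _ = p%:R * (prefix_mean f p x - prefix_mean f p y)).
  rewrite (_ : i%:R * _ = 0 + (i - p)%:R * (G * enorm (x - y))); last first.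
    by field; rewrite gt_eqF.
  apply: lerD; first by rewrite pmulr_rle0 // subr_le0 minx.
  rewrite mulr_natl -[X in _ *+ X](subSS) -sumr_const_nat.
  apply: ler_sum_nat => j /andP[pj ji]; apply: le_trans (ler_norm _) _.
  have [|_ _ lip _ _] := adm (j := j); last exact: lip.
  by rewrite (leq_trans p0 (ltnW pj)) (leq_trans _ i_n).
by rewrite mulrBr !sumE // sumrB.
Qed.

Variables (p i : nat).
Hypotheses (p_i : (0 < p <= i)%N) (i_n : (i <= n)%N).

(** Three epochs rebuild the reference point of stage [p]; the fourth serves stage [i]. *)
Definition epoch_size e := if (e < 3)%N then p else i.
Definition radix k := epoch_size (k %/ T).

Lemma radix_epoch e t : (t < T)%N -> radix (e * T + t) = epoch_size e.
Proof. by move=> tT; rewrite /radix divnMDl // divn_small // addn0. Qed.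

Let i0 : (0 < i)%N.
Proof. by have /andP[p0 ?] := p_i; apply: leq_trans p0 _. Qed.

Let p_n : (0 < p <= n)%N.
Proof. by have /andP[-> ?] := p_i; apply: leq_trans i_n. Qed.

Lemma epoch_size_gt0 e : (0 < epoch_size e)%N.
Proof. by rewrite /epoch_size; case: ifP => // _; have /andP[] := p_n. Qed.

Lemma epoch_size_le e : (epoch_size e <= n)%N.
Proof. by rewrite /epoch_size; case: ifP => // _; have /andP[] := p_n. Qed.

Let ctr e sigma := centre df epoch_size sigma e.

(** Contraction factor of one epoch for the expected squared distance: the factor of [epoch_gap]
    divided by [mu / 2]. *)
Let rho : R := 34 * L ^+ 2 / (mu ^+ 2 * T%:R).

Lemma centre_gap e y : D y ->
  avg radix (e.+1 * T)
    (fun sigma => prefix_mean f (epoch_size e) (ctr e.+1 sigma)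
                  - prefix_mean f (epoch_size e) y) <=
    mu / 2 * rho * avg radix (e * T) (fun sigma => sqn (ctr e sigma - y)).
Proof.
move=> Dy; rewrite mulSn addnC.
rewrite (_ : mu / 2 * rho = 17 * L ^+ 2 / (mu * T%:R)); last first.
  have T0' : 0 < T%:R :> R by rewrite ltr0n.
  by rewrite /rho; field; rewrite !gt_eqF.
apply: (epoch_gap D0 cD kD K0 mu0 L0 (epoch_size_gt0 e) KL KL2
  (adm_prefix (epoch_size_le e))) => //.
- by move=> k; exact: epoch_size_gt0.
- exact: centre_past.
- by move=> sigma; exact: centre_in.
- by move=> t; exact: radix_epoch.
Qed.

(** Each epoch bounds the gap by the previous distance, and quadratic growth turns that gap back
    into a distance. *)
Lemma centre_dist e x : (e <= 3)%N -> is_argmin D (prefix_mean f p) x ->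
  avg radix (e * T) (fun sigma => sqn (ctr e sigma - x)) <=
    rho ^+ e * (2 * G / mu) ^+ 2.
Proof.
move=> e3 xmin; have [Dx _] := xmin; elim: e e3 => [|e IH] e3.
  by rewrite mul0n expr0 mul1r; exact: (argmin_diameter p_n xmin Dx0).
have mu2 : 0 < mu / 2 by rewrite divr_gt0.
rewrite -(ler_pM2l mu2) -avgZ.
have rho0 : 0 <= rho by rewrite divr_ge0 ?mulr_ge0 // ltW.
apply: (@le_trans _ _ (mu / 2 * rho * (rho ^+ e * (2 * G / mu) ^+ 2))).
  apply: le_trans (ler_wpM2l _ (IH (ltnW e3))); last by rewrite mulr_ge0 // ltW.
  apply: le_trans (centre_gap e Dx); apply: ler_avg => sigma.
  rewrite /epoch_size e3; apply: prefix_argmin_strong => //.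
  exact: centre_in.
by rewrite [rho ^+ e.+1]exprS -(mulrA rho) [leRHS]mulrA.
Qed.

(** The reference point is near the minimizer [x] of stage [p] by [centre_dist], and [x] is near [y]
    by [argmin_drift]; the fourth epoch turns this distance into a gap. *)
Lemma stage_gap (alpha : R) y :
  (i - p)%:R <= alpha * i%:R -> rho ^+ 3 <= alpha ^+ 2 ->
  is_argmin D (prefix_mean f i) y ->
  avg radix (4 * T)
    (fun sigma => prefix_mean f i (ctr 4 sigma) - prefix_mean f i y) <=
    272 * L ^+ 2 * G ^+ 2 * alpha ^+ 2 / (mu ^+ 3 * T%:R).
Proof.
move=> ip rho3 ymin; have [Dy _] := ymin.
have [x xmin] := exists_prefix_argmin p_n.
apply: le_trans (centre_gap 3 Dy) _.
have T0' : 0 < T%:R :> R by rewrite ltr0n.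
have mu2rho0 : 0 <= mu / 2 * rho.
  by rewrite mulr_ge0 ?divr_ge0 ?mulr_ge0 // ltW.
have i0R : 0 < i%:R :> R by rewrite ltr0n.
have ip0 : 0 <= (i - p)%:R / i%:R :> R by rewrite divr_ge0.
have q0 : 0 <= (2 * G / mu) ^+ 2 by rewrite sqr_ge0.
have dist : avg radix (3 * T) (fun sigma => sqn (ctr 3 sigma - y)) <=
    4 * ((2 * G / mu) ^+ 2 * alpha ^+ 2).
  apply: (@le_trans _ _ (avg radix (3 * T)
     (fun sigma => 2 * sqn (ctr 3 sigma - x) + 2 * sqn (x - y)))).
    apply: ler_avg => sigma; apply: le_trans (sqnD_le _ _).
    by rewrite addrA subrK.
  rewrite avgD avgZ avg_cst; last by move=> k; exact: epoch_size_gt0.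
  have H1 : avg radix (3 * T) (fun sigma => sqn (ctr 3 sigma - x)) <=
      (2 * G / mu) ^+ 2 * alpha ^+ 2.
    by apply: le_trans (centre_dist _ xmin) _ => //; rewrite mulrC ler_wpM2l.
  have H2 : sqn (x - y) <= (2 * G / mu) ^+ 2 * alpha ^+ 2.
    apply: le_trans (argmin_drift p_i i_n xmin ymin) _.
    rewrite (_ : 2 * _ / mu = 2 * G / mu * ((i - p)%:R / i%:R)); last first.
      by field; rewrite !gt_eqF.
    rewrite exprMn ler_wpM2l // lerXn2r ?nnegrE //.
      by apply: le_trans ip0 _; rewrite ler_pdivrMr.
    by rewrite ler_pdivrMr.
  lra.
(* [272 = 34 / 2 * 4 * 2 ^ 2]. *)
apply: le_trans (ler_wpM2l mu2rho0 dist) _.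
by rewrite le_eqVlt; apply/orP; left; apply/eqP; rewrite /rho; field; rewrite !gt_eqF.
Qed.

End Stage.

(** * Digits of a uniform real *)

Section Digits.
Variable R : realType.
Implicit Types (b sigma : nat -> nat) (S k M : nat) (u : R).

Definition level b k : nat := \prod_(0 <= l < k) b l.

(** Mixed-radix expansion of [u], shifted by one because the functions are numbered from 1. *)
Definition digits b u : nat -> nat :=
  fun k => (Num.truncn ((level b k.+1)%:R * u) %% b k).+1.

Lemma digits_range b u k : (0 < b k)%N -> (1 <= digits b u k <= b k)%N.
Proof. by move=> b0; rewrite /digits /= ltn_pmod. Qed.

(** Lets a later stage reproduce the random indices behind a reference point it has not renewed. *)
Lemma eq_digits b b' u k : (forall l, (l <= k)%N -> b l = b' l) ->
  digits b u k = digits b' u k.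
Proof.
move=> E; rewrite /digits E // /level; congr (Num.truncn (_%:R * _) %% _).+1.
by apply: eq_big_nat => l /andP[_ lk]; apply: E.
Qed.

Lemma levelS b k : level b k.+1 = (level b k * b k)%N.
Proof. by rewrite /level big_nat_recr. Qed.

Lemma level_gt0 b k : (forall l, (0 < b l)%N) -> (0 < level b k)%N.
Proof. by move=> b0; apply: prodn_gt0. Qed.

Lemma truncn_div u M : (0 < M)%N ->
  (Num.truncn (u * M%:R) %/ M)%N = Num.truncn u.
Proof.
move=> M0; have MR : 0 < M%:R :> R by rewrite ltr0n.
have [u0|u0] := leP 0 u; last first.
  by rewrite !truncn_floor !leNgt u0 nmulr_rlt0 // MR /= div0n.
have uM0 : 0 <= u * M%:R by rewrite mulr_ge0 // ltW.
apply/esym/eqP; rewrite truncn_eq //.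
have /andP[H1 H2] := truncn_itv uM0.
rewrite -(ler_pM2r MR) -(ltr_pM2r MR) -!natrM; apply/andP; split.
  by apply: le_trans H1; rewrite ler_nat leq_divM.
by apply: lt_le_trans H2 _; rewrite ler_nat ltn_ceil.
Qed.

(** The same digits read off the single integer [Num.truncn ((level b S)%:R * u)], least significant
    digit last. *)
Fixpoint digits_of_nat b S (m : nat) : nat -> nat :=
  if S is s.+1 then upd (digits_of_nat b s (m %/ b s)) s (m %% b s).+1
  else fun=> 0%N.

Lemma digits_of_truncn b S u k : (forall l, (0 < b l)%N) -> (k < S)%N ->
  digits_of_nat b S (Num.truncn ((level b S)%:R * u)) k = digits b u k.
Proof.
move=> b0; elim: S => // S IH; rewrite ltnS leq_eqVlt => /predU1P[->|kS] /=.
  by rewrite /upd eqxx.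
rewrite /upd ltn_eqF // -IH // levelS natrM mulrAC truncn_div //.
Qed.

(** Euclidean division by the last radix identifies the nested means with one uniform mean over the
    integers below [level b S]. *)
Lemma avg_digits_of_nat b S (F : (nat -> nat) -> R) : (forall l, (0 < b l)%N) ->
  avg b S F = (level b S)%:R^-1 *
    \sum_(0 <= m < level b S) F (digits_of_nat b S m).
Proof.
move=> b0; elim: S F => [|S IH] F /=.
  by rewrite /level big_geq // big_nat1 invr1 mul1r.
rewrite IH levelS natrM invfM -mulrA; congr (_ * _).
rewrite big_nat_mul mulr_sumr; apply: eq_bigr => m _.
congr (_ * _); rewrite big_add1 mulSn (addnC (b S)) /=.
rewrite -[X in _ = \sum_(X <= j < _) _]add0n [RHS]big_addn addKn.
apply: eq_big_nat => j /= jb.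
by rewrite addnC divnMDl // divn_small // addn0 modnMDl modn_small.
Qed.

Lemma truncn_mul_eq M m u : (0 < M)%N -> 0 <= u ->
  (Num.truncn (M%:R * u) == m) = (m%:R / M%:R <= u < m.+1%:R / M%:R).
Proof.
move=> M0 u0; have MR : 0 < M%:R :> R by rewrite ltr0n.
by rewrite truncn_eq ?mulr_ge0 // ler_pdivrMr // ltr_pdivlMr // mulrC.
Qed.

Lemma measurable_truncn_mul M (psi : nat -> R) : (0 < M)%N ->
  measurable_fun [set: R] (fun u => psi (Num.truncn (M%:R * u))).
Proof.
move=> M0 _ Y mY; rewrite setTI.
have MR : 0 < M%:R :> R by rewrite ltr0n.
rewrite [X in measurable X](_ : _ = \bigcup_(m in psi @^-1` Y)
    [set u : R | Num.truncn (M%:R * u) = m]); last first.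
  apply/seteqP; split=> [u Yu|u [m Ym mE]]; last by rewrite -mE in Ym.
  by exists (Num.truncn (M%:R * u)).
(* The level set of 0 contains all negative reals, where [Num.truncn] is 0; the others are bounded
   intervals. *)
apply: bigcup_measurable => -[|m] _.
  rewrite (_ : [set _ | _] = [set` `]-oo, M%:R^-1[]); first exact: measurable_itv.
  have uE u : (Num.truncn (M%:R * u) == 0%N) = (u < M%:R^-1).
    by rewrite -leqn0 truncn_le_nat -ltr_pdivlMl // mulr1.
  by apply/seteqP; split=> u /=; rewrite in_itv /= -uE => /eqP.
rewrite (_ : [set _ | _] = [set` `[m.+1%:R / M%:R, m.+2%:R / M%:R[]).
  exact: measurable_itv.
apply/seteqP; split=> u /=; rewrite in_itv /= => H.
  rewrite -truncn_mul_eq ?H // leNgt; apply/negP => u0.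
  by move: H; rewrite truncn_floor pmulr_rge0 // leNgt u0.
apply/eqP; rewrite truncn_mul_eq //.
by case/andP: H => H _; apply: le_trans H; rewrite divr_ge0.
Qed.

Definition uniform01 : probability (measurableTypeR R) R :=
  uniform_prob (@ltr01 R).

Lemma uniform01_itv (x y : R) : 0 <= x -> x <= y -> y <= 1 ->
  uniform01 `[x, y[%classic = (y - x)%:E.
Proof.
move=> x0 xy y1; rewrite /uniform01 /= /uniform_prob.
rewrite (eq_integral (fun=> 1%:E)); last first.
  move=> u /[!inE] /=; rewrite in_itv /= => /andP[xu uy].
  by rewrite /uniform_pdf (le_trans x0 xu) (le_trans (ltW uy) y1) /= subr0 invr1.
rewrite integral_cst //= mul1e lebesgue_measure_itv /= lte_fin.
by move: xy; rewrite le_eqVlt => /predU1P[->|->]; rewrite ?ltxx ?subrr -?EFinB.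
Qed.

(** On [[0, 1[] the integrand is a step function with [M] cells of mass [1 / M]. *)
Lemma expectation_truncn_mul M (psi : nat -> R) : (0 < M)%N ->
  'E_uniform01[fun u => psi (Num.truncn (M%:R * u))]%E =
  (M%:R^-1 * \sum_(0 <= m < M) psi m)%:E.
Proof.
move=> M0; have MR : 0 < M%:R :> R by rewrite ltr0n.
pose B m : set R := [set` `[m%:R / M%:R, m.+1%:R / M%:R[].
have mB m : measurable (B m) by exact: measurable_itv.
have iB m : uniform01.-integrable setT
    (fun u => (psi m)%:E * (\1_(B m) u)%:E)%E.
  by apply: integrableZl => //; apply: integrable_indic; exact: mB.
have eB m : (\int[uniform01]_u (\1_(B m) u)%:E = uniform01 (B m))%E.
  by rewrite integral_indic ?setIT //; exact: mB.
rewrite unlock (@ae_eq_integral _ _ _ uniform01 _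
    (fun u => \sum_(0 <= m < M) (psi m)%:E * (\1_(B m) u)%:E)%E) //.
- rewrite integral_sum // mulr_sumr -sumEFin; apply: eq_big_nat => m /= mM.
  rewrite integralZl //; last by apply: integrable_indic; exact: mB.
  rewrite eB uniform01_itv ?divr_ge0 //.
  + by rewrite -EFinM mulrC -mulrBl -natrB // subSnn mul1r.
  + by rewrite ler_pM2r ?invr_gt0 // ler_nat.
  + by rewrite ler_pdivrMr // mul1r ler_nat.
- by apply/measurable_realfun.measurable_EFinP; exact: measurable_truncn_mul.
- have /integrableP[] : uniform01.-integrable setT (fun u =>
    \sum_(0 <= m < M) (psi m)%:E * (\1_(B m) u)%:E)%E by exact: integrable_sum.
  by [].
have m01 : measurable (`[0, 1[%classic : set (measurableTypeR R)).
  exact: measurable_itv.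
exists (~` `[0, 1[%classic); split.
- exact: measurableC.
- apply: etrans (probability_setC uniform01 m01) _.
  by rewrite uniform01_itv // subr0 subee.
move=> u /= /not_implyP[_ Hu]; rewrite in_itv /= => /andP[u0 u1]; apply: Hu.
have uM : 0 <= M%:R * u by rewrite mulr_ge0.
have tM : (Num.truncn (M%:R * u) < M)%N.
  by rewrite truncn_lt_nat // -[ltRHS]mulr1 ltr_pM2l.
have inB m : u \in B m = (Num.truncn (M%:R * u) == m).
  by rewrite truncn_mul_eq // mem_setE in_itv.
rewrite (bigD1_seq (Num.truncn (M%:R * u))) ?mem_index_iota ?iota_uniq //=.
rewrite indicE inB eqxx mule1 big1 ?adde0 // => m mt.
by rewrite indicE inB eq_sym (negbTE mt) mule0.
Qed.

Lemma expectation_digits b S (F : (nat -> nat) -> R) : (forall l, (0 < b l)%N) ->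
  past_only S F -> 'E_uniform01[fun u => F (digits b u)]%E = (avg b S F)%:E.
Proof.
move=> b0 FS; rewrite avg_digits_of_nat // -expectation_truncn_mul ?level_gt0 //.
congr ('E_uniform01[_])%E; apply/funext => u.
by apply: FS => k kS; rewrite digits_of_truncn.
Qed.

Lemma measurable_digits b S (F : (nat -> nat) -> R) : (forall l, (0 < b l)%N) ->
  past_only S F ->
  measurable_fun [set: measurableTypeR R] (fun u : R => F (digits b u)).
Proof.
move=> b0 FS; rewrite (_ : (fun u => _) = fun u : R =>
    F (digits_of_nat b S (Num.truncn ((level b S)%:R * u)))).
  apply: (measurable_truncn_mul (fun m => F (digits_of_nat b S m))).
  exact: level_gt0.
by apply/funext => u; apply: FS => k kS; rewrite digits_of_truncn.
Qed.

End Digits.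

(** * Execution and query complexity *)

Section Refresh.
Variables (R : realType) (alpha : R).
Hypothesis alpha1 : alpha < 1.

(* The stage at which the reference point in force at stage i was computed. *)
Fixpoint refresh (i : nat) : nat :=
  if i is k.+1 then
    if alpha * i%:R < (i - refresh k)%:R then i else refresh k
  else 0%N.

Lemma refresh_le i : (refresh i <= i)%N.
Proof. by elim: i => //= i IH; case: ifP => // _; exact: leqW. Qed.

(** Since [alpha < 1], stage 1 always computes a reference point. *)
Lemma refresh_gt0 i : (0 < i)%N -> (0 < refresh i)%N.
Proof.
elim: i => // -[_ _|i IH _]; first by rewrite /= mulr1 subn0 alpha1.
by rewrite [refresh _.+2]/=; case: ifP => // _; exact: IH.
Qed.

Lemma refreshS i : refresh i.+1 = i.+1 \/ refresh i.+1 = refresh i.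
Proof. by rewrite /=; case: ifP => _; [left|right]. Qed.

Lemma refresh_gap i : 0 <= alpha -> (i - refresh i)%:R <= alpha * i%:R.
Proof.
move=> a0; case: i => [|i] /=; first by rewrite mulr_ge0.
case: ifPn => [_|]; first by rewrite subnn mulr_ge0.
by rewrite -leNgt.
Qed.

(** A renewal at [i] has [alpha * i] below its distance to the previous renewal; these distances
    telescope to [refresh n], the bound carried by the induction. *)
Lemma refresh_cost n :
  alpha * (\sum_(1 <= i < n.+1) (refresh i == i) * i)%:R <= n%:R.
Proof.
apply: (@le_trans _ _ (refresh n)%:R); last by rewrite ler_nat refresh_le.
elim: n => [|n IH]; first by rewrite big_geq // mulr0.
rewrite big_nat_recr //= natrD mulrDr; case: ifPn => [H|_].
  rewrite eqxx mul1n -lerBrDr; apply: le_trans IH _.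
  by rewrite lerBrDr -lerBrDl -natrB ?ltW //; exact/leqW/refresh_le.
have := refresh_le n; rewrite leqNgt ltn_neqAle => nr.
rewrite (_ : (refresh n == n.+1) = false) ?mul0n ?mulr0 ?addr0 //.
by apply/negbTE; rewrite neq_ltn ltnS refresh_le.
Qed.

End Refresh.

Section Method.
Variables (R : realType) (d : nat) (D : set 'rV[R]_d).
Variables (mu alpha : R) (K T : nat) (x0 : 'rV[R]_d).
Hypotheses (D0 : D !=set0) (cD : convex_set D) (kD : compact D).
Hypotheses (K0 : (0 < K)%N) (T0 : (0 < T)%N) (Dx0 : D x0).
Hypothesis alpha1 : alpha < 1.
Variable u : R.
Implicit Types (O df : nat -> 'rV[R]_d -> 'rV[R]_d) (h : history R d).

Definition stage_size i := epoch_size (refresh alpha i) i.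

(** All stages read the same [u]: each accuracy claim concerns the law of one stage only. *)
Definition stage_digits i := digits (radix T (refresh alpha i) i) u.

Definition stage_centre O i e : 'rV[R]_d :=
  centre D mu K T x0 O (stage_size i) (stage_digits i) e.

Definition stage_iterate O i e s : 'rV[R]_d :=
  (sgd D mu K (stage_size i e) O (stage_centre O i e)
     (fun t => stage_digits i (e * T + t)%N) s).1.

(* Step k is step k %% T of epoch k %/ T; its needs include the gradients that
   were computed at an earlier stage. *)
Definition needs O i k : seq (query R d) :=
  if (k %% T == 0)%N then
    [seq (stage_centre O i (k %/ T), j) | j <- iota 1 (stage_size i (k %/ T))]
  else [:: (stage_iterate O i (k %/ T) (k %% T), stage_digits i k)].

(** Without renewal, the first three epochs are replayed from old answers, and step [3 * T] lacks
    only the gradient of the newest function. *)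
Definition asked O i k : seq (query R d) :=
  if (refresh alpha i == i) || (3 * T < k)%N then needs O i k
  else if (k == 3 * T)%N then [:: (stage_centre O i 3, i)] else [::].

(** The rules see nothing but the history, so each round replays its stage from the recorded
    answers. The default 0 stands for queries not yet answered. *)
Definition lookup h : nat -> 'rV[R]_d -> 'rV[R]_d := fun j x =>
  foldr (fun (m : {fmap query R d -> 'rV[R]_d}) v => odflt v m.[? (x, j)]%fmap)
    0 h.

Lemma stage_size_range i e : (0 < i)%N -> (0 < stage_size i e <= i)%N.
Proof.
move=> i0; rewrite /stage_size /epoch_size; case: ifP => _; last by rewrite i0 /=.
by rewrite refresh_gt0 // refresh_le.
Qed.

Lemma stage_digits_range i e t : (0 < i)%N -> (t < T)%N ->
  (0 < stage_digits i (e * T + t) <= stage_size i e)%N.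
Proof.
move=> i0 tT; rewrite /stage_size -(radix_epoch T0 _ _ _ tT).
apply: digits_range; rewrite radix_epoch //.
by have /andP[] := stage_size_range e i0.
Qed.

Lemma stage_centre_in O i e : D (stage_centre O i e).
Proof. exact: centre_in. Qed.

Lemma needs_in O i k q : (0 < i)%N -> q \in needs O i k ->
  D q.1 /\ (1 <= q.2 <= i)%N.
Proof.
move=> i0; rewrite /needs; case: ifP => _.
  case/mapP => j; rewrite mem_iota add1n ltnS => /andP[j1 jN] -> /=.
  split; first exact: stage_centre_in.
  have /andP[_ Ni] := stage_size_range (k %/ T) i0.
  by rewrite j1 (leq_trans jN).
rewrite inE => /eqP -> /=; split.
  by have [] := sgd_in mu D0 cD kD K0 (stage_size i (k %/ T)) O
    (fun t => stage_digits i (k %/ T * T + t)%N) (k %% T)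
    (stage_centre_in O i (k %/ T)).
have /andP[_ Ni] := stage_size_range (k %/ T) i0.
have := stage_digits_range (k %/ T) i0 (ltn_pmod k T0); rewrite -divn_eq.
by move=> /andP[_ kN]; rewrite (leq_trans kN Ni).
Qed.

Lemma asked_in O i k q : (0 < i)%N -> q \in asked O i k ->
  D q.1 /\ (1 <= q.2 <= i)%N.
Proof.
move=> i0; rewrite /asked; case: ifP => _; first exact: needs_in.
case: ifP => // _; rewrite inE => /eqP -> /=.
by rewrite i0 leqnn; split=> //; exact: stage_centre_in.
Qed.

Lemma csvrg_queries_in i t h (q : query R d) : (0 < i)%N ->
  q \in [fset q in asked (lookup h) i t.-1]%fset -> D q.1 /\ (1 <= q.2 <= i)%N.
Proof. by move=> i0; rewrite inE => /(asked_in i0). Qed.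

(** One round per step; rounds count from 1 and steps from 0, hence [t.-1]. *)
Definition csvrg : first_order_method D := {|
  start := x0;
  nrounds := fun _ _ => (4 * T)%N;
  iterate := fun _ _ _ => x0;
  queries := fun i t h => [fset q in asked (lookup h) i t.-1]%fset;
  output := fun i h => stage_centre (lookup h) i 4;
  start_in := Dx0;
  iterate_in := fun _ _ _ => Dx0;
  queries_in := csvrg_queries_in;
  output_in := fun i h => stage_centre_in (lookup h) i 4 |}.

Variable df : nat -> 'rV[R]_d -> 'rV[R]_d.

Definition agree O (s : seq (query R d)) :=
  forall q, q \in s -> O q.2 q.1 = df q.2 q.1.

Lemma agree_centre O i k : (k %% T == 0)%N -> agree O (needs df i k) ->
  forall j, (1 <= j <= stage_size i (k %/ T))%N ->
  O j (stage_centre df i (k %/ T)) = df j (stage_centre df i (k %/ T)).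
Proof.
move=> kT agr j jN; apply: (agr (stage_centre df i (k %/ T), j)).
by rewrite /needs kT map_f // mem_iota add1n ltnS.
Qed.

(** The state after a step depends on the oracle only through the needs of the steps made, so
    agreement there suffices. *)
Lemma sgd_causal O i e s : (0 < i)%N -> (s <= T)%N ->
  stage_centre O i e = stage_centre df i e ->
  (forall k, (k < e * T + s)%N -> agree O (needs df i k)) ->
  sgd D mu K (stage_size i e) O (stage_centre O i e)
     (fun t => stage_digits i (e * T + t)%N) s =
  sgd D mu K (stage_size i e) df (stage_centre df i e)
     (fun t => stage_digits i (e * T + t)%N) s.
Proof.
move=> i0 sT ->; elim: s sT => //= s IH sT agr; rewrite {}IH; last 2 first.
- exact: ltnW.
- by move=> k ks; apply: agr; rewrite addnS ltnS ltnW.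
have eTs : (e * T < e * T + s.+1)%N by rewrite addnS ltnS leq_addr.
have eT0 : ((e * T) %% T == 0)%N by rewrite modnMl.
have agr_c := agree_centre eT0 (agr _ eTs).
rewrite (mulnK _ T0) in agr_c.
set x := sgd _ _ _ _ _ _ _ s.
suff E : vr_gradient (stage_size i e) O (stage_centre df i e)
      (stage_digits i (e * T + s)) x.1 =
    vr_gradient (stage_size i e) df (stage_centre df i e)
      (stage_digits i (e * T + s)) x.1 by rewrite /sgd_step E.
have sN := stage_digits_range e i0 sT.
rewrite /vr_gradient agr_c //; congr (_ - _ + _ *: _); last first.
  by apply: eq_big_nat => j; exact: agr_c.
(* The first iterate of an epoch is its reference point, whose gradients are already listed; hence
   [needs] has no extra query there. *)
have [s0|s0] := posnP s.
  have -> : x.1 = stage_centre df i e by rewrite /x s0.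
  exact: agr_c.
have ks : (e * T + s < e * T + s.+1)%N by rewrite addnS.
have := agr _ ks; rewrite /needs modnMDl divnMDl // modn_small // divn_small //.
rewrite addn0 -(negbK (s == 0)%N) -lt0n s0 /=.
by move=> /(_ (stage_iterate df i e s, stage_digits i (e * T + s))); apply; rewrite inE.
Qed.

Lemma centre_causal O i e : (0 < i)%N ->
  (forall k, (k < e * T)%N -> agree O (needs df i k)) ->
  stage_centre O i e = stage_centre df i e.
Proof.
move=> i0; elim: e => // e IH agr.
rewrite /stage_centre /= -!/(stage_centre _ i e) sgd_causal //.
  by apply: IH => k ke; apply: agr; rewrite mulSn (leq_trans ke) ?leq_addl.
by move=> k ke; apply: agr; rewrite mulSn addnC.
Qed.

(** The queries of step [k] follow from earlier answers, so replaying the history is not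
    circular. *)
Lemma needs_causal O i k : (0 < i)%N ->
  (forall l, (l < k)%N -> agree O (needs df i l)) -> needs O i k = needs df i k.
Proof.
move=> i0 agr.
have cE : stage_centre O i (k %/ T) = stage_centre df i (k %/ T).
  apply: centre_causal => // l lk; apply: agr.
  by rewrite (leq_trans lk) // leq_trunc_div.
rewrite /needs cE; case: ifP => // _; congr [:: (_, _)].
congr (_.1); apply: sgd_causal => //; first exact/ltnW/ltn_pmod.
by rewrite -divn_eq.
Qed.

Lemma asked_causal O i k : (0 < i)%N ->
  (forall l, (l < k)%N -> agree O (needs df i l)) -> asked O i k = asked df i k.
Proof.
move=> i0 agr; rewrite /asked needs_causal //; case: ifP => // _.
by case: eqP => // kE; rewrite centre_causal // -kE.
Qed.

Definition consistent h := forall (m : {fmap query R d -> 'rV[R]_d}) q v,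
  m \in h -> m.[? q]%fmap = Some v -> v = df q.2 q.1.

Definition answered h (q : query R d) :=
  has (fun m : {fmap query R d -> 'rV[R]_d} => q \in domf m) h.

Lemma lookup_answered h q : consistent h -> answered h q ->
  lookup h q.2 q.1 = df q.2 q.1.
Proof.
rewrite /answered; case: q => x j /=; elim: h => //= m h IH ch.
case: fndP => [qm _|qm] /=.
  by apply: (ch m (x, j)); rewrite ?mem_head // in_fnd.
move=> ha.
by apply: IH => // m' q v m'h; apply: ch; rewrite inE m'h orbT.
Qed.

Definition settled h i k :=
  forall l, (l < k)%N -> all (answered h) (needs df i l).

Lemma settled_agree h i k : consistent h -> settled h i k ->
  forall l, (l < k)%N -> agree (lookup h) (needs df i l).
Proof.
by move=> ch sh l lk q qn; apply: lookup_answered => //; apply: (allP (sh l lk)).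
Qed.

(* What stage i inherits from the previous ones when it does not renew the
   reference point. *)
Definition warm h i := refresh alpha i != i -> settled h i (3 * T) /\
  forall j, (0 < j < i)%N -> answered h (stage_centre df i 3, j).

Lemma answered_rcons h m q :
  answered (rcons h m) q = (q \in domf m) || answered h q.
Proof. exact: has_rcons. Qed.

Lemma consistent_rcons h (Q : {fset query R d}) :
  consistent h -> consistent (rcons h (answers df Q)).
Proof.
move=> ch m q v; rewrite mem_rcons inE => /predU1P[->|]; last exact: ch.
by case: fndP => // qQ [<-]; rewrite ffunE.
Qed.

Lemma settled_rcons h m i k : settled h i k -> settled (rcons h m) i k.
Proof.
move=> sh l /sh; apply: sub_all => q qh.
by rewrite answered_rcons qh orbT.
Qed.

Lemma warm_rcons h m i : warm h i -> warm (rcons h m) i.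
Proof.
move=> wh /wh[sh jh]; split; first exact: settled_rcons.
by move=> j /jh; rewrite answered_rcons orbC => ->.
Qed.

Lemma csvrg_queries h i k : (0 < i)%N -> consistent h -> settled h i k ->
  queries csvrg i k.+1 h = [fset q in asked df i k]%fset.
Proof.
move=> i0 ch sh; rewrite -(@asked_causal (lookup h)) //.
exact: settled_agree.
Qed.

Lemma round_settled h i k : (0 < i)%N -> consistent h -> warm h i ->
  settled h i k ->
  settled (rcons h (answers df (queries csvrg i k.+1 h))) i k.+1.
Proof.
move=> i0 ch wh sh; rewrite csvrg_queries //.
move=> l; rewrite ltnS leq_eqVlt => /predU1P[->|]; last exact: settled_rcons.
apply/allP => q qn; rewrite answered_rcons.
have -> : (q \in domf (answers df [fset q in asked df i k]%fset)) =
    (q \in asked df i k) by rewrite inE.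
rewrite /asked; case: ifPn => [_|]; first by rewrite qn.
rewrite negb_or -leqNgt => /andP[ri k3]; have [sh3 jh] := wh ri.
move: k3; rewrite leq_eqVlt => /predU1P[kE|k3]; last first.
  by rewrite (allP (sh3 k k3)) // orbT.
(* At step [3 * T], the gradients of index below [i] are inherited and the one of index [i] is
   asked. *)
move: qn; rewrite kE eqxx /needs modnMl mulnK // /stage_size /epoch_size /=.
case/mapP => j; rewrite mem_iota add1n ltnS => /andP[j1 ji] ->.
move: ji; rewrite leq_eqVlt => /predU1P[->|ji]; first by rewrite inE eqxx.
by rewrite jh ?orbT // j1.
Qed.

Lemma run_rounds_invariant h i t : (0 < i)%N -> consistent h -> warm h i ->
  let h' := run_rounds csvrg df i t h in
  [/\ consistent h', warm h' i & settled h' i t].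
Proof.
move=> i0 ch wh; elim: t => [//|t [ct wt st]] /=; split.
- exact: consistent_rcons.
- exact: warm_rcons.
- exact: round_settled.
Qed.

Lemma stage_digits_kept i k : refresh alpha i.+1 = refresh alpha i ->
  (k < 3 * T)%N -> stage_digits i.+1 k = stage_digits i k.
Proof.
move=> ri k3; apply: eq_digits => l lk; rewrite ri /radix /epoch_size.
by rewrite ltn_divLR // (leq_ltn_trans lk).
Qed.

Lemma stage_centre_kept i e : refresh alpha i.+1 = refresh alpha i ->
  (e <= 3)%N -> stage_centre df i.+1 e = stage_centre df i e.
Proof.
move=> ri e3; apply: eq_centre => [e' e'e|s se].
  by rewrite /stage_size /epoch_size ri (leq_trans e'e).
by apply: stage_digits_kept => //; rewrite (leq_trans se) // leq_mul2r e3 orbT.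
Qed.

Lemma needs_kept i k : refresh alpha i.+1 = refresh alpha i ->
  (k < 3 * T)%N -> needs df i.+1 k = needs df i k.
Proof.
move=> ri k3; have e3 : (k %/ T < 3)%N by rewrite ltn_divLR.
have sE : stage_size i.+1 (k %/ T) = stage_size i (k %/ T).
  by rewrite /stage_size /epoch_size e3.
rewrite /needs /stage_iterate sE stage_centre_kept ?(ltnW e3) //.
case: ifP => // _; rewrite stage_digits_kept //; congr [:: (_.1, _)].
apply: eq_sgd => s sk; apply: stage_digits_kept => //.
rewrite (leq_trans _ k3) // {2}(divn_eq k T) ltnS.
by rewrite leq_add2l ltnW.
Qed.

Lemma run_stages_invariant i (h := run_stages csvrg df i) :
  [/\ consistent h, warm h i.+1 & (0 < i)%N -> settled h i (4 * T)].
Proof.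
rewrite {}/h; elim: i => [|i [ch wh _]].
  (* Stage 1 is a renewal, so it inherits nothing. *)
  split=> //; rewrite /warm => /negP[]; rewrite eqn_leq refresh_le.
  exact: refresh_gt0.
have -> : run_stages csvrg df i.+1 =
  run_rounds csvrg df i.+1 (4 * T) (run_stages csvrg df i) by [].
have [ch' _ sh'] := run_rounds_invariant (4 * T) (ltn0Sn i) ch wh.
split=> //; rewrite /warm.
case: (refreshS alpha i.+1) => [->|ri]; first by rewrite eqxx.
(* Without renewal, the next stage repeats the first three epochs of the stage just ended, whose
   step [3 * T] settled all gradients so far at the common reference point. *)
move=> _; split=> [l l3|j /andP[j0 ji]].
  by rewrite needs_kept //; apply: sh'; rewrite (leq_trans l3) // leq_mul2r orbT.
rewrite stage_centre_kept //.
apply: (allP (sh' (3 * T)%N _)); first by rewrite ltn_mul2r T0.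
rewrite /needs modnMl mulnK // eqxx map_f // mem_iota j0 add1n.
by rewrite /stage_size /epoch_size.
Qed.

Lemma stage_output_csvrg i : (0 < i)%N ->
  stage_output csvrg df i = stage_centre df i 4.
Proof.
case: i => // i _; have [ch _ /(_ isT) sh] := run_stages_invariant i.+1.
by apply: centre_causal => //; exact: settled_agree.
Qed.

Lemma stage_queries_csvrg i k : (0 < i)%N -> (k < 4 * T)%N ->
  stage_queries csvrg df i k.+1 = [fset q in asked df i k]%fset.
Proof.
case: i => // i _ k4; have [ch wh _] := run_stages_invariant i.
have [ch' _ sh'] := run_rounds_invariant k (ltn0Sn i) ch wh.
exact: csvrg_queries.
Qed.

Lemma size_needs i k : (0 < i)%N ->
  (size (needs df i k) <= 1 + (k %% T == 0) * i)%N.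
Proof.
move=> i0; rewrite /needs; case: ifP => // _.
rewrite size_map size_iota mul1n.
have /andP[_ Ni] := stage_size_range (k %/ T) i0.
by rewrite (leq_trans Ni) // leq_addl.
Qed.

Lemma size_asked i k : (0 < i)%N -> (k < 4 * T)%N ->
  (size (asked df i k) <= 1 + (k %% T == 0) * ((refresh alpha i == i) * i))%N.
Proof.
move=> i0 k4; rewrite /asked; case: eqP => [_|_] /=.
  by rewrite mul1n; exact: size_needs.
rewrite mul0n muln0 addn0; case: ifP => [k3|_]; last by case: ifP.
(* No multiple of [T] lies strictly between [3 * T] and [4 * T], hence no full gradient. *)
rewrite /needs ifN // -lt0n lt0n; apply/negP => /eqP kT.
move: k3 k4; rewrite (divn_eq k T) kT addn0 !ltn_mul2r T0 /=.
by move=> k3; rewrite ltnS leqNgt k3.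
Qed.

(** Each of the [4 * T] rounds costs at most one query, plus a full gradient at the four epoch
    starts of a renewal stage. *)
Lemma fo_complexity_csvrg n : (fo_complexity csvrg df n <=
  4 * T * n + 4 * \sum_(1 <= i < n.+1) (refresh alpha i == i) * i)%N.
Proof.
rewrite /fo_complexity.
apply: (@leq_trans (\sum_(1 <= i < n.+1)
  (4 * T + 4 * ((refresh alpha i == i) * i)))); last first.
  by rewrite big_split /= sum_nat_const_nat subSS subn0 mulnC big_distrr.
rewrite big_nat_cond [leqRHS]big_nat_cond; apply: leq_sum => i /andP[/andP[i0 _] _].
rewrite big_add1 -[_.-1]/(4 * T)%N; set c := (_ * i)%N.
apply: (@leq_trans (\sum_(0 <= k < 4 * T) (1 + (k %% T == 0) * c))).
  rewrite big_nat_cond [leqRHS]big_nat_cond; apply: leq_sum => k /andP[/andP[_ k4] _].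
  rewrite stage_queries_csvrg // card_fseq (leq_trans (size_undup _)) //.
  exact: size_asked.
rewrite big_split /= sum_nat_const_nat subn0 muln1 leq_add2l -big_distrl /=.
rewrite leq_mul2r; apply/orP; right.
rewrite big_nat_mul (eq_bigr (fun=> 1%N)) ?sum_nat_const_nat // => e _.
rewrite big_ltn ?ltn_mul2r ?T0 ?ltnSn // modnMl eqxx big_nat_cond big1 ?addn0 //.
move=> k /andP[/andP[ek ke] _]; apply/eqP; rewrite eqb0.
apply/negP => /eqP kT; move: ek ke; rewrite (divn_eq k T) kT addn0 !ltn_mul2r T0 /=.
by move=> ek; rewrite ltnS leqNgt ek.
Qed.

End Method.

(** * Choice of the parameters *)

Lemma powR_third (R : realType) (x : R) : 0 <= x -> (x `^ (1 / 3)) ^+ 3 = x.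
Proof.
by move=> x0; rewrite -powR_mulrn ?powR_ge0 // -powRrM divfK // powRr1.
Qed.

Lemma powR_two_thirds (R : realType) (x : R) :
  0 <= x -> (x `^ (2 / 3)) ^+ 3 = x ^+ 2.
Proof.
move=> x0; rewrite -powR_mulrn ?powR_ge0 // -powRrM divfK //.
by rewrite -powR_mulrn.
Qed.

(** From [ln (1 + x) <= x] at [x = - 1 / 2]; it lets the logarithm in the bound absorb constants. *)
Lemma ln_nat_ge_half (R : realType) (n : nat) : (2 <= n)%N -> 1 / 2 <= ln n%:R :> R.
Proof.
move=> n2; apply: (@le_trans _ _ (ln 2)); last first.
  by rewrite ler_ln ?posrE ?ltr0n ?(ltnW n2) // ler_nat.
have := @le_ln1Dx R (- (1 / 2)); rewrite (_ : 1 + - (1 / 2) = 2^-1 :> R); last by field.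
rewrite lnV ?posrE // => /(_ _); lra.
Qed.

Section Tuning.
Variables (R : realType) (mu L G eps : R).
Hypotheses (mu0 : 0 < mu) (L0 : 0 < L) (G0 : 0 < G) (eps0 : 0 < eps).

Definition offset : nat := (Num.truncn (16 * L / mu + 32 * L ^+ 2 / mu ^+ 2)).+1.

Lemma offset_gt : 16 * L / mu + 32 * L ^+ 2 / mu ^+ 2 < offset%:R.
Proof.
have a0 : 0 <= 16 * L / mu + 32 * L ^+ 2 / mu ^+ 2.
  by rewrite addr_ge0 // divr_ge0 ?mulr_ge0 // ltW // ?exprn_gt0.
by have /andP[] := truncn_itv a0.
Qed.

Lemma offset_ge1 : 16 * L <= mu * offset%:R.
Proof.
rewrite [leRHS]mulrC -ler_pdivrMr //; apply: ltW; apply: le_lt_trans _ offset_gt.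
by rewrite lerDl divr_ge0 ?mulr_ge0 // ltW.
Qed.

Lemma offset_ge2 : 32 * L ^+ 2 <= mu ^+ 2 * offset%:R.
Proof.
rewrite [leRHS]mulrC -ler_pdivrMr ?exprn_gt0 //; apply: ltW.
apply: le_lt_trans _ offset_gt.
by rewrite lerDr divr_ge0 ?mulr_ge0 // ltW.
Qed.

(** The three entries serve [rate_lt1], [epoch_length_offset] and [contraction_small], in this
    order. *)
Definition rate_bound : R :=
  Num.min 1 (Num.min (L ^+ 2 / (mu ^+ 2 * offset%:R ^+ 2)) (mu ^+ 6 / L ^+ 6)).

Lemma rate_bound_gt0 : 0 < rate_bound.
Proof.
by rewrite !lt_min ltr01 !divr_gt0 ?mulr_gt0 ?exprn_gt0.
Qed.

(* Proportion of new functions after which the reference point is renewed. *)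
Definition rate : R := mu * eps `^ (1 / 3) / (L `^ (2 / 3) * G `^ (2 / 3)).

Lemma rate_gt0 : 0 < rate.
Proof. by rewrite divr_gt0 ?mulr_gt0 ?powR_gt0. Qed.

Lemma rate_cube : rate ^+ 3 = mu ^+ 3 * eps / (L ^+ 2 * G ^+ 2).
Proof.
rewrite expr_div_n !exprMn powR_third ?(ltW eps0) //.
by rewrite !powR_two_thirds ?(ltW L0) ?(ltW G0).
Qed.

Lemma rate_lt_bound :
  eps < rate_bound ^+ 3 * (L ^+ 2 * G ^+ 2) / mu ^+ 3 -> rate < rate_bound.
Proof.
move=> He; rewrite -(@ltr_pXn2r _ 3) ?nnegrE ?(ltW rate_gt0) ?(ltW rate_bound_gt0) //.
rewrite rate_cube ltr_pdivrMr ?mulr_gt0 ?exprn_gt0 //.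
by rewrite mulrC -ltr_pdivlMr ?exprn_gt0.
Qed.

(** 272 is the constant of [stage_gap]: with [rate * T >= 272], its bound becomes
    [rate ^+ 3 * L ^+ 2 * G ^+ 2 / mu ^+ 3], which is [eps]. *)
Definition epoch_length : nat := (Num.truncn (272 / rate)).+1.

Lemma epoch_length_gt : 272 / rate < epoch_length%:R.
Proof.
have a0 : 0 <= 272 / rate by rewrite divr_ge0 // ltW // rate_gt0.
by have /andP[] := truncn_itv a0.
Qed.

Hypothesis rate_small : rate < rate_bound.

Lemma rate_lt1 : rate < 1.
Proof. by apply: lt_le_trans rate_small _; rewrite ge_min lexx. Qed.

Lemma epoch_length_le : epoch_length%:R <= 273 / rate.
Proof.
have r0 := rate_gt0; have r1 := rate_lt1.
have a0 : 0 <= 272 / rate by rewrite divr_ge0 // ltW.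
have /andP[H _] := truncn_itv a0.
have i1 : 1 <= rate^-1 by rewrite invf_ge1 // ltW.
rewrite /epoch_length -natr1; move: H i1; set t := _%:R; lra.
Qed.

Lemma rate_epoch_length : 272 <= rate * epoch_length%:R.
Proof. by rewrite mulrC -ler_pdivrMr ?rate_gt0 // ltW // epoch_length_gt. Qed.

Lemma epoch_length_offset :
  mu ^+ 2 * offset%:R ^+ 2 <= 4 * L ^+ 2 * epoch_length%:R.
Proof.
have r0 := rate_gt0; rewrite -(ler_pM2l r0).
have Hr : rate * (mu ^+ 2 * offset%:R ^+ 2) <= L ^+ 2.
  rewrite -ler_pdivlMr ?mulr_gt0 ?exprn_gt0 //; apply: ltW.
  by apply: lt_le_trans rate_small _; rewrite !ge_min lexx orbT.
apply: le_trans Hr _.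
have L2 : 0 <= L ^+ 2 by exact: sqr_ge0.
have := ler_wpM2r L2 rate_epoch_length; lra.
Qed.

(** One epoch contracts by at most [L ^+ 2 * rate / mu ^+ 2]. Of the three factors [rate], two give
    the target and the third absorbs [L ^+ 6 / mu ^+ 6]. *)
Lemma contraction_small :
  (34 * L ^+ 2 / (mu ^+ 2 * epoch_length%:R)) ^+ 3 <= rate ^+ 2.
Proof.
have r0 := rate_gt0.
have T0 : 0 < epoch_length%:R :> R by rewrite ltr0n.
have Hr : rate * L ^+ 6 <= mu ^+ 6.
  rewrite -ler_pdivlMr ?exprn_gt0 //; apply: ltW.
  by apply: lt_le_trans rate_small _; rewrite !ge_min lexx !orbT.
apply: (@le_trans _ _ ((L ^+ 2 * rate / mu ^+ 2) ^+ 3)).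
  have p0 : 0 <= 34 * L ^+ 2 / (mu ^+ 2 * epoch_length%:R).
    by rewrite divr_ge0 ?mulr_ge0 // ltW.
  suff pq : 34 * L ^+ 2 / (mu ^+ 2 * epoch_length%:R) <= L ^+ 2 * rate / mu ^+ 2.
    by rewrite lerXn2r ?nnegrE // (le_trans p0).
  rewrite ler_pdivrMr ?mulr_gt0 ?exprn_gt0 //.
  rewrite [leRHS](_ : _ = L ^+ 2 * (rate * epoch_length%:R)); last first.
    by field; rewrite gt_eqF.
  rewrite mulrC ler_wpM2l ?sqr_ge0 //; apply: le_trans rate_epoch_length.
  by rewrite ler_nat.
rewrite expr_div_n ler_pdivrMr ?exprn_gt0 //.
have -> : (L ^+ 2 * rate) ^+ 3 = rate ^+ 2 * (rate * L ^+ 6) by ring.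
by rewrite -exprM ler_wpM2l // sqr_ge0.
Qed.

Lemma gap_le_eps :
  272 * L ^+ 2 * G ^+ 2 * rate ^+ 2 / (mu ^+ 3 * epoch_length%:R) <= eps.
Proof.
have r0 := rate_gt0.
have T0 : 0 < epoch_length%:R :> R by rewrite ltr0n.
have LG : 0 < L ^+ 2 * G ^+ 2 by rewrite mulr_gt0 ?exprn_gt0.
rewrite ler_pdivrMr ?mulr_gt0 ?exprn_gt0 //.
have := rate_cube => /(congr1 ( *%R^~ (L ^+ 2 * G ^+ 2))).
rewrite /= divfK ?gt_eqF // => E.
rewrite (_ : eps * _ = (mu ^+ 3 * eps) * epoch_length%:R); last by ring.
rewrite -E.
rewrite (_ : rate ^+ 3 * _ * _ =
  (L ^+ 2 * G ^+ 2 * rate ^+ 2) * (rate * epoch_length%:R)); last by ring.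
rewrite (_ : 272 * _ * _ * _ = (L ^+ 2 * G ^+ 2 * rate ^+ 2) * 272); last by ring.
by rewrite ler_wpM2l ?rate_epoch_length // mulr_ge0 ?sqr_ge0 // ltW.
Qed.

End Tuning.

(** * Accuracy and cost of the tuned method *)

Section Correctness.
Variables (R : realType) (d : nat) (D : set 'rV[R]_d).
Variables (mu L G eps : R) (x0 : 'rV[R]_d).
Hypotheses (D0 : D !=set0) (cD : convex_set D) (kD : compact D) (Dx0 : D x0).
Hypotheses (mu0 : 0 < mu) (L0 : 0 < L) (G0 : 0 < G) (eps0 : 0 < eps).
Hypothesis rate_small : rate mu L G eps < rate_bound mu L.

Let alpha := rate mu L G eps.
Let K := offset mu L.
Let T := epoch_length mu L G eps.
Let K0 : (0 < K)%N := ltn0Sn _.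
Let T0 : (0 < T)%N := ltn0Sn _.
Let M := csvrg mu D0 cD kD K0 T0 Dx0 (rate_lt1 rate_small).

Variables (n : nat) (f : nat -> 'rV[R]_d -> R) (df : nat -> 'rV[R]_d -> 'rV[R]_d).
Hypothesis adm :
  forall j, (1 <= j <= n)%N -> admissible D mu L G (f j) (df j).

Let out i sigma :=
  centre D mu K T x0 df (epoch_size (refresh alpha i) i) sigma 4.
Let b i := radix T (refresh alpha i) i.

Let outE i u : (0 < i)%N ->
  stage_output (M u) df i = out i (digits (b i) u).
Proof. exact: stage_output_csvrg. Qed.

Let refresh_range i : (0 < i)%N -> (0 < refresh alpha i <= i)%N.
Proof. by move=> i0; rewrite refresh_gt0 ?refresh_le ?(rate_lt1 rate_small). Qed.

Let b_gt0 i l : (0 < i)%N -> (0 < b i l)%N.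
Proof. by move=> i0; apply: (epoch_size_gt0 (refresh_range i0) (leqnn i)). Qed.

Let out_past i : past_only (4 * T) (out i).
Proof. exact: centre_past. Qed.

Lemma csvrg_random_vector i : (0 < i)%N ->
  random_vector (T := measurableTypeR R) (fun u => stage_output (M u) df i).
Proof.
move=> i0 k.
have -> : (fun u => stage_output (M u) df i 0 k) =
    (fun u => out i (digits (b i) u) 0 k).
  by apply/funext => u; rewrite outE.
apply: (@measurable_digits _ _ (4 * T) (fun sigma => out i sigma 0 k)).
  by move=> l; exact: b_gt0.
by move=> sigma sigma' E; rewrite (out_past i E).
Qed.

Lemma csvrg_gap i y : (1 <= i <= n)%N -> is_argmin D (prefix_mean f i) y ->
  ('E_(uniform01 R) [fun u : R => prefix_mean f i (stage_output (M u) df i)]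
   - (prefix_mean f i y)%:E <= eps%:E)%E.
Proof.
move=> /andP[i0 i_n] ymin.
have -> : (fun u => prefix_mean f i (stage_output (M u) df i)) =
    (fun u => prefix_mean f i (out i (digits (b i) u))).
  by apply/funext => u; rewrite outE.
have bi0 l : (0 < b i l)%N by exact: b_gt0.
rewrite (@expectation_digits _ _ (4 * T)
  (fun sigma => prefix_mean f i (out i sigma))) //; last first.
  by move=> sigma sigma' E; rewrite (out_past i E).
rewrite -EFinB lee_fin; apply: le_trans (gap_le_eps mu0 L0 G0 eps0).
rewrite -(avg_cst (4 * T) (prefix_mean f i y) bi0) -mulN1r -avgZ -avgD.
under eq_avg do rewrite mulN1r.
apply: (stage_gap D0 cD kD K0 T0 Dx0 mu0 L0 G0 (offset_ge1 mu0 L0)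
  (offset_ge2 mu0 L0) (epoch_length_offset mu0 L0 G0 eps0 rate_small) adm
  (refresh_range i0) i_n) => //.
- exact/refresh_gap/ltW/rate_gt0.
- exact: contraction_small.
Qed.

(** [274 = 273 + 1] adds the epochs, through [epoch_length_le], to the renewals; the factor 2 comes
    from [ln_nat_ge_half]. *)
Lemma csvrg_complexity u : (2 <= n)%N ->
  (fo_complexity (M u) df n)%:R <=
    2 * (4 * 274) * (n%:R * ln n%:R / alpha).
Proof.
move=> n2; have a0 : 0 < alpha by exact: rate_gt0.
have := fo_complexity_csvrg mu D0 cD kD K0 T0 Dx0 (rate_lt1 rate_small) u df n.
rewrite -/M -(ler_nat R) => /le_trans; apply.
rewrite natrD !natrM -/alpha.
have Hc : (\sum_(1 <= i < n.+1) (refresh alpha i == i) * i)%:R <= n%:R / alpha.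
  by rewrite ler_pdivlMr // mulrC refresh_cost.
have HT : T%:R * n%:R <= 273 / alpha * n%:R.
  by rewrite ler_wpM2r // epoch_length_le.
have Hn : n%:R / alpha <= 2 * (n%:R * ln n%:R / alpha).
  have na : 0 <= n%:R / alpha by rewrite divr_ge0 // ltW.
  by have := ler_wpM2l na (ln_nat_ge_half R n2); lra.
lra.
Qed.

End Correctness.

Theorem theorem1 (R : realType) :
  exists (C : R) (eps0 : R -> R -> R -> R -> R),
    0 < C /\
    (forall mu L G Delta : R, 0 < eps0 mu L G Delta) /\
    forall (d : nat) (D : set 'rV[R]_d) (mu L G eps : R),
      D !=set0 -> convex_set D -> compact D ->
      0 < mu -> 0 < L -> 0 < G ->
      0 < eps -> eps < eps0 mu L G (diam D) ->
      exists CSVRG : randomized_method D,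
        forall (n : nat) (f : nat -> 'rV[R]_d -> R)
               (df : nat -> 'rV[R]_d -> 'rV[R]_d),
          (2 <= n)%N ->
          (forall i : nat, (1 <= i <= n)%N ->
             admissible D mu L G (f i) (df i)) ->
          (forall i : nat, (1 <= i <= n)%N ->
             random_vector (random_output (A := CSVRG) df i) /\
             forall xstar : 'rV[R]_d,
               is_argmin D (prefix_mean f i) xstar ->
               ('E_(seed_law CSVRG)
                  [fun w => prefix_mean f i (random_output df i w)]
                - (prefix_mean f i xstar)%:E <= eps%:E)%E) /\
          (forall w : seed CSVRG,
             (fo_complexity (derandomize w) df n)%:R <=
             C * (L `^ (2 / 3) * G `^ (2 / 3) / mu
                    * (n%:R * ln n%:R / eps `^ (1 / 3))
                  + L ^+ 2 * G / mu `^ (5 / 2)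
                    * (ln n%:R / Num.sqrt eps))).
Proof.
(* The threshold must be positive for all arguments, hence the value 1 off the positive range. *)
exists (2 * (4 * 274)), (fun mu L G _ => if [&& 0 < mu, 0 < L & 0 < G] then
  rate_bound mu L ^+ 3 * (L ^+ 2 * G ^+ 2) / mu ^+ 3 else 1).
split; first by rewrite !mulr_gt0 // ltr0n.
split=> [mu L G _|].
  case: ifP => [/and3P[mu0 L0 G0]|_]; last exact: ltr01.
  by rewrite divr_gt0 ?mulr_gt0 ?exprn_gt0 ?rate_bound_gt0.
move=> d D mu L G eps D0 cD kD mu0 L0 G0 eps_gt0; rewrite mu0 L0 G0 /= => eps_lt.
have rate_small := rate_lt_bound mu0 L0 G0 eps_gt0 eps_lt.
have [x0 Dx0] := D0.
exists (@RandomizedMethod R d D _ (measurableTypeR R) (uniform01 R)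
  (@csvrg R d D mu (rate mu L G eps) (offset mu L) (epoch_length mu L G eps) x0
     D0 cD kD (ltn0Sn _) (ltn0Sn _) Dx0 (rate_lt1 rate_small))).
move=> n f df n2 adm; split=> [i i_n|u].
  split=> [|y ymin]; last first.
    exact: (csvrg_gap D0 cD kD Dx0 mu0 L0 G0 eps_gt0 rate_small adm i_n ymin).
  have /andP[i0 _] := i_n.
  exact: (csvrg_random_vector D0 cD kD Dx0 rate_small df i0).
apply: le_trans (csvrg_complexity D0 cD kD Dx0 mu0 L0 G0 eps_gt0 rate_small df u n2) _.
(* The first summand equals [n%:R * ln n%:R / rate] and the second is nonnegative. *)
rewrite ler_wpM2l ?mulr_ge0 // ler_wpDr //.
  by rewrite mulr_ge0 ?divr_ge0 ?mulr_ge0 ?sqr_ge0 ?powR_ge0 ?sqrtr_ge0 ?ln_ge0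
    ?ler1n ?(ltW G0) ?(ltW L0) ?(ltnW n2).
rewrite le_eqVlt; apply/orP; left; apply/eqP; rewrite /rate.
by field; rewrite !gt_eqF ?powR_gt0.
Qed.
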